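(* Let $(\phi_t)_{t\ge 0}$ be a non-elliptic semigroup of holomorphic functions in the unit disk $\mathbb{D}$, let $\Delta$ be a petal of $(\phi_t)$, and let $K$ be a compact non-polar subset of $\Delta$. Then, for every $z\in\Delta\setminus K$, the harmonic measure $\omega(\phi_t(z),\partial\phi_t(K),\mathbb{D}\setminus\phi_t(K))$ is an increasing function of $t\in(-\infty,0]$.
   Context: $\mathbb{D}$ is the open unit disk. A (one-parameter) semigroup of holomorphic functions in $\mathbb{D}$ is a family $(\phi_t)_{t\ge0}$ of holomorphic maps $\phi_t:\mathbb{D}\to\mathbb{D}$ such that $\phi_0$ is the identity, $\phi_{t+s}=\phi_t\circ\phi_s$ for all $s,t\ge0$, and $\phi_t(z)\to z$ as $t\to0^+$ uniformly on compact subsets of $\mathbb{D}$. It is called non-elliptic if there is a point $\tau\in\partial\mathbb{D}$ (the Denjoy–Wolff point) with $\lim_{t\to+\infty}\phi_t(z)=\tau$ for every $z\in\mathbb{D}$. A non-elliptic semigroup is called parabolic if the angular derivatives satisfy $\phi_t'(\tau)=1$. Let $d_{\mathbb{D}}(z,w)=\operatorname{arctanh}\left|\frac{z-w}{1-\bar z w}\right|$ be the hyperbolic distance. A backward orbit of $(\phi_t)$ starting at a point $z\in\mathbb{D}$ is a continuous curve $\gamma:[0,+\infty)\to\mathbb{D}$ with $\gamma(0)=z$ and $\phi_s(\gamma(t))=\gamma(t-s)$ for all $t\ge0$, $s\in[0,t]$; it is regular if $\limsup_{t\to+\infty}d_{\mathbb{D}}(\gamma(t),\gamma(t+1))<+\infty$.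 The backward invariant set is $\mathcal{W}=\bigcap_{t\ge0}\phi_t(\mathbb{D})$. A petal $\Delta$ of $(\phi_t)$ is a non-empty simply connected component of the interior of $\mathcal{W}$ such that: (i) $\phi_t(\Delta)=\Delta$ for all $t\ge0$ and $(\phi_t|_{\Delta})$ is a group of automorphisms of $\Delta$; (ii) $\tau\in\partial\Delta$; (iii) there is a point $\sigma\in\partial\mathbb{D}\cap\partial\Delta$ (possibly $\sigma=\tau$) such that for every $z\in\Delta$ the curve $[0,+\infty)\ni t\mapsto(\phi_t|_\Delta)^{-1}(z)$ is a regular backward orbit for $(\phi_t)$ converging to $\sigma$; moreover $\sigma$ is a boundary regular fixed point (a boundary fixed point at which each $\phi_t$ has finite angular derivative), and if $\sigma=\tau$ then the semigroup is parabolic. For $t>0$ and $z\in\Delta$ one writes $\phi_{-t}(z):=(\phi_t|_\Delta)^{-1}(z)$, so $\phi_t$ is defined on $\Delta$ for all $t\in\mathbb{R}$. A compact set is polar if its logarithmic capacity is zero. For a domain $D$ with non-polar boundary and a compact non-polar $E\subset D$, $\omega(z,\partial E,D\setminus E)$ denotes harmonic measure: the Perron solution, evaluated at $z\in D\setminus E$, of the generalized Dirichlet problem on the open set $D\setminus E$ with boundary values $1$ on $\partial E$ and $0$ on $\partial D$. ''Increasing'' is meant in the non-strict sense. *)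

(* Defs.v *)
From HB Require Import structures.
From mathcomp Require Import all_boot all_order all_algebra.
From mathcomp Require Import all_classical all_reals all_analysis.
From mathcomp Require Import complex.

Set Implicit Arguments.
Unset Strict Implicit.
Unset Printing Implicit Defensive.

Import Order.TTheory GRing.Theory Num.Theory numFieldNormedType.Exports.

Local Open Scope classical_set_scope.
Local Open Scope ring_scope.
Local Open Scope complex_scope.

(* The complex plane is [R[i]^o]: the copy [_^o] is the one that carries the
   topology and the structure of normed module over the field [R[i]] itself, so
   that [derivable f z 1] is complex differentiability. *)

Section ComplexPlane.
Context {R : realType}.
Local Notation C := (R[i]^o).

(* The norm [`|z|] of [R[i]] is [R[i]]-valued; this is the same number in [R]. *)
Definition modulus (z : C) : R := ComplexField.Normc.normc z.

Definition unit_disk : set C := [set z | modulus z < 1].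

Definition unit_circle : set C := [set z | modulus z = 1].

Definition boundary (A : set C) : set C := closure A `\` A°.

Definition holomorphic_on (U : set C) (f : C -> C) : Prop :=
  forall z, U z -> derivable f z 1.

Definition automorphism (U : set C) (f : C -> C) : Prop :=
  [/\ set_bij U U f, holomorphic_on U f
    & holomorphic_on U ('pinv_(fun=> 0) U f)].

Definition simply_connected (A : set C) : Prop :=
  (forall x y, A x -> A y -> exists g : R -> C,
     [/\ {within `[0, 1], continuous g}, g @` `[0, 1] `<=` A, g 0 = x
       & g 1 = y]) /\
  (forall g : R -> C,
     {within `[0, 1], continuous g} -> g @` `[0, 1] `<=` A -> g 0 = g 1 ->
     exists H : R * R -> C,
       [/\ {within `[0, 1] `*` `[0, 1], continuous H},
           H @` (`[0, 1] `*` `[0, 1]) `<=` A,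
           (forall t, t \in `[0, 1] -> H (0, t) = g t /\ H (1, t) = g 0)
         & (forall s, s \in `[0, 1] -> H (s, 0) = g 0 /\ H (s, 1) = g 0)]).

Definition artanh (x : R) : R := ln ((1 + x) / (1 - x)) / 2.

Definition hyperbolic_dist (z w : C) : R :=
  artanh (modulus ((z - w) / (1 - conjc z * w))).

Definition stolz_region (sigma : C) (M : R) : set C :=
  [set z | unit_disk z /\ modulus (sigma - z) < M * (1 - modulus z)].

Definition angular_limit (f : C -> C) (sigma l : C) : Prop :=
  forall M : R, 1 < M ->
    f z @[z --> within (stolz_region sigma M) (nbhs sigma)] --> l.

Definition angular_derivative (f : C -> C) (sigma l : C) : Prop :=
  exists2 p : C, angular_limit f sigma p
    & angular_limit (fun z => (f z - p) / (z - sigma)) sigma l.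

End ComplexPlane.

Section Semigroups.
Context {R : realType}.
Local Notation C := (R[i]^o).

(* Only the values [phi t z] with [0 <= t] and [z] in the unit disk matter. *)
Definition holomorphic_semigroup (phi : R -> C -> C) : Prop :=
  [/\ (forall t, 0 <= t -> holomorphic_on unit_disk (phi t)),
      (forall t z, 0 <= t -> unit_disk z -> unit_disk (phi t z)),
      (forall z, unit_disk z -> phi 0 z = z),
      (forall s t z, 0 <= s -> 0 <= t -> unit_disk z ->
         phi (t + s) z = phi t (phi s z))
    & (forall A : set C, compact A -> A `<=` unit_disk ->
         {uniform A, phi t @[t --> 0^'+] --> id})].

Definition denjoy_wolff_point (phi : R -> C -> C) (tau : C) : Prop :=
  unit_circle tau /\
  forall z, unit_disk z -> phi t z @[t --> +oo] --> tau.

Definition non_elliptic (phi : R -> C -> C) : Prop :=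
  holomorphic_semigroup phi /\ exists tau, denjoy_wolff_point phi tau.

Definition parabolic (phi : R -> C -> C) : Prop :=
  non_elliptic phi /\
  forall tau, denjoy_wolff_point phi tau ->
    forall t, 0 <= t -> angular_derivative (phi t) tau 1.

Definition backward_orbit (phi : R -> C -> C) (z : C) (gamma : R -> C) : Prop :=
  [/\ {within `[0, +oo[, continuous gamma},
      (forall t, 0 <= t -> unit_disk (gamma t)),
      gamma 0 = z
    & (forall s t, 0 <= s <= t -> phi s (gamma t) = gamma (t - s))].

Definition regular_orbit (gamma : R -> C) : Prop :=
  (limf_esup (fun t : R => (hyperbolic_dist (gamma t) (gamma (t + 1)))%:E)
     (pinfty_nbhs R) < +oo)%E.

Definition boundary_regular_fixed_point (phi : R -> C -> C) (sigma : C) : Prop :=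
  unit_circle sigma /\
  forall t, 0 <= t -> angular_limit (phi t) sigma sigma /\
    exists l, angular_derivative (phi t) sigma l.

Definition backward_invariant_set (phi : R -> C -> C) : set C :=
  \bigcap_(t in [set t : R | 0 <= t]) (phi t @` unit_disk).

(* [phi_t] on [Delta] for every real [t]; for [t < 0] it is the inverse of
   [phi_(-t)] restricted to [Delta]. *)
Definition petal_flow (phi : R -> C -> C) (Delta : set C) (t : R) : C -> C :=
  if 0 <= t then phi t else 'pinv_(fun=> 0) Delta (phi (- t)).

Definition petal (phi : R -> C -> C) (Delta : set C) : Prop :=
  [/\ exists2 x, (backward_invariant_set phi)° x
        & Delta = connected_component (backward_invariant_set phi)° x,
      simply_connected Delta,
      (forall t, 0 <= t -> automorphism Delta (phi t)),
      (forall tau, denjoy_wolff_point phi tau -> boundary Delta tau)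
    & exists sigma,
        [/\ unit_circle sigma, boundary Delta sigma,
            (forall z, Delta z ->
               let gamma t := petal_flow phi Delta (- t) z in
               [/\ backward_orbit phi z gamma, regular_orbit gamma
                 & gamma t @[t --> +oo] --> sigma]),
            boundary_regular_fixed_point phi sigma
          & denjoy_wolff_point phi sigma -> parabolic phi]].

End Semigroups.

Section PotentialTheory.
Context {R : realType}.
Local Notation C := (R[i]^o).

Local Open Scope ereal_scope.

Definition borel_plane := g_sigma_algebraType (@open C).

Definition log_energy (E : set C) (mu : probability borel_plane R) : \bar R :=
  \int[mu]_(z in E) \int[mu]_(w in E) - lne (modulus (z - w))%:E.

(* For compact [E]; the infimum is the Robin constant of [E], with value [+oo]
   when every energy is infinite, and then the capacity is [expeR -oo = 0]. *)
Definition log_capacity (E : set C) : \bar R :=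
  expeR (- ereal_inf [set log_energy E mu
                     | mu in [set mu : probability borel_plane R | mu E = 1]]).

Definition polar (E : set C) : Prop := log_capacity E = 0.

Definition circle_point (z : C) (r t : R) : C :=
  (z + Complex (r * cos t) (r * sin t))%R.

(* [Omega] is meant to be open; the function identically [-oo] is allowed. The
   integral is that of a function bounded above on the circle, hence a
   well-defined element of [[-oo, +oo[]. *)
Definition subharmonic (Omega : set C) (u : C -> \bar R) : Prop :=
  forall z, Omega z ->
    [/\ u z < +oo,
        (forall a : R, u z < a%:E -> \forall w \near z, u w < a%:E)
      & exists2 rho : R, (0 < rho)%R & forall r : R, (0 < r < rho)%R ->
          u z <= (2 * pi)^-1%:E *
            \int[@lebesgue_measure R]_(t in `[0%R, (2 * pi)%R])
              u (circle_point z r t)].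

(* For bounded open [Omega], whose boundary in the sphere does not contain the
   point at infinity. *)
Definition perron_solution (Omega : set C) (f : C -> R) (z : C) : \bar R :=
  ereal_sup [set u z | u in [set u : C -> \bar R | subharmonic Omega u /\
    forall zeta, boundary Omega zeta ->
      limf_esup u (within Omega (nbhs zeta)) <= (f zeta)%:E]].

(* omega(z, B, Omega): boundary values [1] on [B] and [0] on the rest of the
   boundary of [Omega]. *)
Definition harmonic_measure (z : C) (B Omega : set C) : \bar R :=
  perron_solution Omega \1_B z.

End PotentialTheory.

(* Main.v *)
Require Import Defs.
From mathcomp Require Import all_boot all_order all_algebra.
From mathcomp Require Import all_classical all_reals all_analysis measurable_realfun.
From mathcomp Require Import complex.
From mathcomp Require Import ring lra.

Set Implicit Arguments.
Unset Strict Implicit.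
Unset Printing Implicit Defensive.

Import Order.TTheory GRing.Theory Num.Theory numFieldNormedType.Exports.

Local Open Scope classical_set_scope.
Local Open Scope ring_scope.
Local Open Scope complex_scope.

Local Notation Re := (@complex.Re _).
Local Notation Im := (@complex.Im _).

(** The harmonic measure decreases when one goes backward in time because of
    the subordination principle: if [h] is a holomorphic map of the disk into
    itself and [A] is a compact subset of the disk, then the harmonic measure of
    [A] seen from [a] is at most that of [h(A)] seen from [h(a)]
    ([harmonic_measure_subordination]). For [s <= t <= 0] the map [phi_(t-s)]
    sends [phi_s(K)] onto [phi_t(K)] and [phi_s(z)] to [phi_t(z)], since [phi_s]
    and [phi_t] are inverse to [phi_(-s)] and [phi_(-t)] on the petal.

    Subordination is proved by pushing forward Perron competitors. For [u] in the
    Perron family of the complement of [A], let [U(w)] be the supremum of [0] and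
    of the values of [u] on the fibre of [h] over [w]. Clearly [u <= U o h], so it
    is enough that [U] belongs to the Perron family of the complement of [h(A)].
    The boundary values are right: points of a fibre over [w] approach the unit
    circle when [w] does, and [u <= 1] everywhere. Upper semicontinuity is
    compactness of the closed disk ([near_fibre]). The points of the fibre that
    escape to the unit circle are harmless, as [u] is small there and [U >= 0].

    The submean inequality for [U] is the heart of the matter, because circles
    are not preserved by [h]. One compares instead with real parts of holomorphic
    functions. If [p] is a polynomial whose real part is above [U] on a circle,
    then [Re (p o h)] is above [u] on the boundary of the preimage of the disk,
    hence in it by the maximum principle, and so [U <= Re p] at the centre
    ([push_forward_centre]). It remains to find such polynomials whose value at
    the centre is close to the mean of [U] ([le_circle_mean]): [U] is approximated
    from above by Lipschitz functions, which lie below Fejer sums of nearly the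
    same mean.

    The maximum principle ([maximum_principle]) only uses the submean inequality
    on small circles and the mean value property of holomorphic functions, and
    the latter follows from Goursat's theorem on rectangles ([goursat]) in
    logarithmic polar coordinates ([mean_value_property]). *)

(** * The complex plane with a real-valued modulus *)

Section ComplexPlane.
Context {R : realType}.
Local Notation C := (R[i]^o).
Implicit Types z w : C.

Lemma normCE z : `|z| = (modulus z)%:C.
Proof. by case: z. Qed.

Lemma modulus_ge0 z : 0 <= modulus z.
Proof. by case: z => a b; exact: sqrtr_ge0. Qed.

Lemma modulusM z w : modulus (z * w) = modulus z * modulus w.
Proof. exact: ComplexField.Normc.normcM. Qed.

Lemma modulusD z w : modulus (z + w) <= modulus z + modulus w.
Proof. exact: le_normcD. Qed.

Lemma modulusN z : modulus (- z) = modulus z.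
Proof. exact: normcN. Qed.

Lemma modulusB z w : modulus (z - w) = modulus (w - z).
Proof. by rewrite -modulusN opprB. Qed.

Lemma modulus_triangle z w x : modulus (z - x) <= modulus (z - w) + modulus (w - x).
Proof. by rewrite (le_trans _ (modulusD _ _))// addrA subrK. Qed.

Lemma modulus0 : modulus (0 : C) = 0.
Proof. exact: ComplexField.Normc.normc0. Qed.

Lemma modulus_gt0 z : z != 0 -> 0 < modulus z.
Proof.
move=> z0; rewrite lt_neqAle modulus_ge0 andbT eq_sym.
by apply: contra z0 => /eqP/ComplexField.Normc.eq0_normc ->.
Qed.

Lemma modulusV z : modulus (z^-1 : R[i]) = (modulus z)^-1.
Proof. exact: ComplexField.Normc.normcV. Qed.

Lemma modulus_real (x : R) : modulus (x%:C : C) = `|x|.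
Proof. by rewrite /modulus /= expr0n addr0 sqrtr_sqr. Qed.

Lemma modulus_sqr z : modulus z ^+ 2 = Re z ^+ 2 + Im z ^+ 2.
Proof. by case: z => a b /=; rewrite sqr_sqrtr ?addr_ge0 ?sqr_ge0. Qed.

Lemma le_Re_modulus z : `|Re z| <= modulus z.
Proof.
rewrite -(@ler_pXn2r _ 2) ?nnegrE ?modulus_ge0 // modulus_sqr.
by rewrite real_normK ?num_real // lerDl sqr_ge0.
Qed.

Lemma le_Im_modulus z : `|Im z| <= modulus z.
Proof.
rewrite -(@ler_pXn2r _ 2) ?nnegrE ?modulus_ge0 // modulus_sqr.
by rewrite real_normK ?num_real // lerDr sqr_ge0.
Qed.

Lemma modulus_le z : modulus z <= `|Re z| + `|Im z|.
Proof.
case: z => a b; rewrite [X in modulus X](_ : _ = (a%:C : C) + ('i%C : C) * b%:C).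
  rewrite (le_trans (modulusD _ _))// modulus_real modulusM modulus_real /=.
  by rewrite /modulus /= expr0n expr1n add0r sqrtr1 mul1r.
by simpc.
Qed.

Lemma ReD z w : Re (z + w) = Re z + Re w.
Proof. by case: z w => [? ?] [? ?]. Qed.
Lemma ImD z w : Im (z + w) = Im z + Im w.
Proof. by case: z w => [? ?] [? ?]. Qed.
Lemma ReN z : Re (- z) = - Re z.
Proof. by case: z => [? ?]. Qed.
Lemma ImN z : Im (- z) = - Im z.
Proof. by case: z => [? ?]. Qed.
Lemma ReM z w : Re (z * w) = Re z * Re w - Im z * Im w.
Proof. by case: z w => [? ?] [? ?]. Qed.
Lemma ImM z w : Im (z * w) = Re z * Im w + Im z * Re w.
Proof. by case: z w => [? ?] [? ?]. Qed.

Lemma nbhs_modulusP z (A : set C) :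
  nbhs z A <-> exists2 e : R, 0 < e & forall w, modulus (w - z) < e -> A w.
Proof.
split=> [/nbhs_ballP[e /= e0 zA]|[e e0 zA]].
  move: e e0 zA => [e e'] /[dup] /[!ltcE]/= /andP[/eqP -> e0] _ zA.
  exists e => // w we; apply: zA; rewrite -ball_normE /=.
  by rewrite distrC normCE complexr0 ltcR.
apply/nbhs_ballP; exists e%:C => /=; first by rewrite ltcR.
move=> w; rewrite -ball_normE /= distrC normCE ltcR; exact: zA.
Qed.

Lemma near_modulus z (P : C -> Prop) :
  (\forall w \near z, P w) <->
  exists2 e : R, 0 < e & forall w, modulus (w - z) < e -> P w.
Proof. exact: nbhs_modulusP. Qed.

Lemma open_modulus z (e : R) : open [set w : C | modulus (w - z) < e].
Proof.
rewrite openE => w /= we; apply/nbhs_modulusP; exists (e - modulus (w - z)).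
  by rewrite subr_gt0.
move=> x xw /=; rewrite (le_lt_trans (modulus_triangle x w z))//; lra.
Qed.

Lemma open_unit_disk : open (@unit_disk R).
Proof.
rewrite (_ : unit_disk = [set w : C | modulus (w - 0) < 1]).
  exact: open_modulus.
by apply/seteqP; split => z; rewrite /unit_disk /= subr0.
Qed.

Lemma closed_modulus z (e : R) : closed [set w : C | modulus (w - z) <= e].
Proof.
rewrite (_ : mkset _ = ~` [set w : C | e < modulus (w - z)]); last first.
  by apply/seteqP; split => w /=; rewrite leNgt => /negP.
apply: open_closedC; rewrite openE => w /= we.
apply/nbhs_modulusP; exists (modulus (w - z) - e); first by rewrite subr_gt0.
move=> x xw /=; have := modulus_triangle w x z; rewrite (modulusB w x); lra.
Qed.

Lemma continuousCP (T : topologicalType) (f : T -> C) (t : T) :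
  {for t, continuous f} <->
  forall e : R, 0 < e -> \forall s \near t, modulus (f s - f t) < e.
Proof.
split=> [ft e e0|ft].
  by apply: (ft [set x | modulus (x - f t) < e]); apply/nbhs_modulusP; exists e.
move=> A /nbhs_modulusP[e e0 fA]; near=> s; apply: fA; near: s.
exact: ft.
Unshelve. all: by end_near. Qed.

Lemma continuousCR (f : C -> R) z :
  (forall e : R, 0 < e -> exists2 d : R, 0 < d &
     forall w, modulus (w - z) < d -> `|f w - f z| < e) ->
  {for z, continuous f}.
Proof.
move=> fz; apply/(@cvgrPdist_lt R R C (nbhs z) _ f (f z)) => e e0; apply/near_modulus.
by have [d d0 fd] := fz _ e0; exists d => // w /fd; rewrite distrC.
Qed.

Lemma Re_continuous : continuous (Re : C -> R).
Proof.
move=> z; apply: continuousCR => e e0; exists e => // w wz.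
by rewrite -ReN -ReD (le_lt_trans (le_Re_modulus _)).
Qed.

Lemma Complex_continuous (T : topologicalType) (f g : T -> R) (t : T) :
  {for t, continuous f} -> {for t, continuous g} ->
  {for t, continuous (fun s => Complex (f s) (g s) : C)}.
Proof.
move=> /cvgrPdist_lt ft /cvgrPdist_lt gt; apply/continuousCP => e e0.
have e20 : 0 < e / 2 by rewrite divr_gt0.
near=> s; rewrite (le_lt_trans (modulus_le _))// ReD ImD ReN ImN /=.
rewrite (splitr e) ltrD// distrC; near: s; [exact: ft|exact: gt].
Unshelve. all: by end_near. Qed.

(** Heine-Borel in the plane, transported from a product of two segments. *)
Lemma compact_square (r : R) :
  compact [set z : C | `|Re z| <= r /\ `|Im z| <= r].
Proof.
pose S := (`[-r, r]%classic `*` `[-r, r]%classic : set (R * R)).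
rewrite (_ : mkset _ = (fun p : R * R => Complex p.1 p.2 : C) @` S).
  apply: continuous_compact; last by apply: compact_setX; exact: segment_compact.
  apply: continuous_subspaceT => p; apply: Complex_continuous.
    exact: cvg_fst.
  exact: cvg_snd.
apply/seteqP; split => [[a b] /= []|z [[a b]] []] /=.
  by rewrite !ler_norml => ar br; exists (a, b) => //; split; rewrite /= in_itv.
by rewrite !in_itv /= => ar br <-; rewrite /= !ler_norml.
Qed.

Lemma bounded_closed_compactC (A : set C) (r : R) : closed A ->
  (forall z, A z -> modulus z <= r) -> compact A.
Proof.
move=> cA Ar; apply: (subclosed_compact cA (@compact_square r)) => z /Ar zr.
by split; [apply: le_trans (le_Re_modulus _) _|apply: le_trans (le_Im_modulus _) _].
Qed.

Lemma hausdorffC : hausdorff_space C.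
Proof. exact: norm_hausdorff. Qed.

Lemma scaleCE (a : R[i]) (z : C) : a *: z = (a : C) * z.
Proof. by []. Qed.

(** The first order expansion with real error bounds: estimates along real
    rectangles and circles need the norm as a number of [R], not of [R[i]]. *)
Lemma derivable_expansion (f : C -> C) z : derivable f z 1 ->
  forall e : R, 0 < e -> exists2 d : R, 0 < d &
  forall w, modulus (w - z) < d ->
    modulus (f w - f z - 'D_1 f z * (w - z)) <= e * modulus (w - z).
Proof.
move=> df e e0.
have := df; rewrite /derivable => /cvg_ex[l fl].
have -> : 'D_1 f z = l by rewrite /derive; apply: cvg_lim fl; exact: norm_hausdorff.
move/cvgrPdist_lt : fl => /(_ e%:C); rewrite ltcR => /(_ e0).
rewrite /dnbhs near_withinE => /near_modulus[d d0 fd].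
exists d => // w wz; have [->|wz0] := eqVneq w z.
  by rewrite !subrr mulr0 subr0 modulus0 mulr0.
have h0 : w - z != 0 by rewrite subr_eq0.
have := fd (w - z); rewrite subr0 => /(_ wz h0).
rewrite /= normCE ltcR => /ltW fwz.
rewrite -(ler_pdivrMr _ _ (modulus_gt0 h0)) -modulusV -modulusM.
rewrite modulusB in fwz; apply: le_trans fwz.
rewrite !scaleCE mulr1 subrK.
have -> : (w - z)^-1 * (f w - f z) - l =
    (f w - f z - l * (w - z)) * (w - z)^-1.
  by rewrite mulrBl mulfK // mulrC.
exact: lexx.
Qed.

End ComplexPlane.

(** * Goursat's theorem on rectangles *)

Section SegmentIntegral.
Context {R : realType}.
Local Notation mu := (@lebesgue_measure R).
Implicit Types (f g : R -> R) (a b c d k M : R).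

Definition segment_integral f a b : R := \int[mu]_(x in `[a, b]) f x.

Definition segment_continuous f a b : Prop :=
  forall x, a <= x <= b -> {for x, continuous f}.

Lemma segment_integrable f a b : segment_continuous f a b ->
  mu.-integrable `[a, b] (EFin \o f).
Proof.
move=> cf; apply: continuous_compact_integrable; first exact: segment_compact.
by apply: continuous_in_subspaceT => x /set_mem /=; rewrite in_itv => /cf.
Qed.

Lemma segment_integral_split f a b c : a <= c -> c <= b ->
  segment_continuous f a b ->
  segment_integral f a b = segment_integral f a c + segment_integral f c b.
Proof.
move=> ac cb /segment_integrable fi; apply/eqP; rewrite addrC -subr_eq; apply/eqP.
rewrite /segment_integral (Rintegral_itvB fi) ?bnd_simp//.
apply: Rintegral_itv_obnd_cbnd; apply: integrableS fi => //.
by apply: subset_itvr; rewrite bnd_simp.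
Qed.

Lemma segment_integralB f g a b :
  segment_continuous f a b -> segment_continuous g a b ->
  segment_integral (fun x => f x - g x) a b =
  segment_integral f a b - segment_integral g a b.
Proof. by move=> /segment_integrable fi /segment_integrable gi; exact: RintegralB. Qed.

Lemma segment_integral_cst k a b : a <= b ->
  segment_integral (fun=> k) a b = k * (b - a).
Proof.
rewrite le_eqVlt => /predU1P[->|ab].
  by rewrite /segment_integral set_itv1 Rintegral_set1 subrr mulr0.
by rewrite /segment_integral Rintegral_cst//= lebesgue_measure_itv/= lte_fin ab.
Qed.

Lemma segment_continuous_cst k a b : segment_continuous (fun=> k) a b.
Proof. by move=> x _; exact: cvg_cst. Qed.

Lemma segment_continuousB f g a b :
  segment_continuous f a b -> segment_continuous g a b ->
  segment_continuous (fun x => f x - g x) a b.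
Proof. by move=> cf cg x xab; apply: cvgB; [exact: cf|exact: cg]. Qed.

Lemma le_segment_integral f g a b :
  segment_continuous f a b -> segment_continuous g a b ->
  (forall x, a <= x <= b -> f x <= g x) ->
  segment_integral f a b <= segment_integral g a b.
Proof.
move=> /segment_integrable fi /segment_integrable gi fg.
by apply: le_Rintegral => // x /=; rewrite in_itv; exact: fg.
Qed.

Lemma segment_integral_near f a b k M : a <= b -> segment_continuous f a b ->
  (forall x, a <= x <= b -> `|f x - k| <= M) ->
  `|segment_integral f a b - k * (b - a)| <= M * (b - a).
Proof.
move=> ab cf fk; rewrite ler_distl -mulrBl -mulrDl -!segment_integral_cst//.
by apply/andP; split; apply: le_segment_integral => //;
  do ?[exact: segment_continuous_cst]; move=> x /fk; rewrite ler_distl => /andP[].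
Qed.

(** The intervals [[x n, x n + w / 2 ^ n]] are nested. *)
Lemma nested_dyadic (x : nat -> R) (w : R) : 0 <= w ->
  (forall n, x n <= x n.+1 <= x n + w / 2 ^+ n.+1) ->
  exists X, forall n, x n <= X <= x n + w / 2 ^+ n.
Proof.
move=> w0 xn.
have half n : w / 2 ^+ n.+1 + w / 2 ^+ n.+1 = w / 2 ^+ n.
  by rewrite exprS invfM; lra.
have up n (k : nat) : x n <= x (n + k)%N.
  elim: k => [|k IH]; first by rewrite addn0.
  by rewrite addnS (le_trans IH)//; case/andP: (xn (n + k)%N).
have dn n (k : nat) : x (n + k)%N + w / 2 ^+ (n + k) <= x n + w / 2 ^+ n.
  elim: k => [|k IH]; first by rewrite addn0.
  rewrite addnS (le_trans _ IH)//; case/andP: (xn (n + k)%N) => _ h.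
  by rewrite -[in leRHS]half; lra.
have pw n : 0 <= w / 2 ^+ n by rewrite divr_ge0// exprn_ge0.
have xy n m : x n <= x m + w / 2 ^+ m.
  have [/subnKC <-|/ltnW/subnKC <-] := leqP n m.
    by apply: le_trans (up n (m - n)%N) _; rewrite lerDl.
  by apply: le_trans (dn m (n - m)%N); rewrite lerDl.
have ubx m : ubound (range x) (x m + w / 2 ^+ m) by move=> _ [n _ <-].
exists (sup (range x)) => n; apply/andP; split.
  apply: ub_le_sup; last by exists n.
  by exists (x 0%N + w / 2 ^+ 0).
apply: ge_sup; last exact: ubx.
by exists (x 0%N), 0%N.
Qed.

Lemma dyadic_small (w e : R) : 0 <= w -> 0 < e -> exists n, w / 2 ^+ n < e.
Proof.
move=> w0 e0; exists (Num.bound (w / e)).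
rewrite ltr_pdivrMr ?exprn_gt0// mulrC -ltr_pdivrMr//.
have we0 : 0 <= w / e by rewrite divr_ge0// ltW.
rewrite (lt_trans (archi_boundP we0))// -natrX ltr_nat.
exact: ltn_expl.
Qed.

End SegmentIntegral.

Section Goursat.
Context {R : realType}.
Variables P Q : R -> R -> R.
Implicit Types a b c d m x y : R.

(** Total differentiability of [(P, Q)] at a point, the differential being the
    multiplication by the complex number [p - i q]. *)
Definition cauchy_riemann_at x y : Prop :=
  exists p q, forall e : R, 0 < e -> exists2 r, 0 < r &
    forall x' y', `|x' - x| < r -> `|y' - y| < r ->
      `|P x' y' - P x y - (p * (x' - x) + q * (y' - y))| <= e * (`|x' - x| + `|y' - y|) /\
      `|Q x' y' - Q x y - (- q * (x' - x) + p * (y' - y))| <= e * (`|x' - x| + `|y' - y|).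

Definition cauchy_riemann_on a b c d : Prop :=
  forall x y, a <= x <= b -> c <= y <= d -> cauchy_riemann_at x y.

(** The imaginary part of the integral of [(P + i Q) dz] along the boundary. *)
Definition boundary_integral a b c d : R :=
  (segment_integral (P b) c d - segment_integral (P a) c d)
  - (segment_integral (Q^~ d) a b - segment_integral (Q^~ c) a b).

Lemma cauchy_riemann_continuous x y : cauchy_riemann_at x y ->
  [/\ {for y, continuous (P x)}, {for x, continuous (P^~ y)},
      {for y, continuous (Q x)} & {for x, continuous (Q^~ y)}].
Proof.
case=> p [q pq].
have main e : 0 < e -> exists2 r, 0 < r & forall x' y', `|x' - x| < r -> `|y' - y| < r ->
   `|P x' y' - P x y| < e /\ `|Q x' y' - Q x y| < e.
  move=> e0; have [r r0 rP] := pq 1 ltr01.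
  pose M := 2 * (1 + `|p| + `|q|).
  have M0 : 0 < M by rewrite mulr_gt0// -addrA ltr_pwDl// addr_ge0.
  exists (Order.min r (e / M)); first by rewrite lt_min r0 divr_gt0.
  move=> x' y'; rewrite !lt_min => /andP[x'r x'e] /andP[y'r y'e].
  have [] := rP x' y' x'r y'r; rewrite mul1r.
  set u := x' - x in x'e *; set v := y' - y in y'e *.
  rewrite ltr_pdivlMr// in x'e; rewrite ltr_pdivlMr// in y'e.
  have eM : (1 + `|p| + `|q|) * (`|u| + `|v|) < e by rewrite /M in x'e y'e; lra.
  have key (k l X : R) : `|k| <= `|p| + `|q| -> `|l| <= `|p| + `|q| ->
      `|X - (k * u + l * v)| <= `|u| + `|v| -> `|X| < e.
    move=> kpq lpq Xuv; apply: le_lt_trans eM; rewrite -addrA -(subrK (k * u + l * v) X).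
    apply: le_trans (ler_normD _ _) _; rewrite mulrDl mul1r lerD//.
    by apply: le_trans (ler_normD _ _) _; rewrite !normrM mulrDr lerD// ler_wpM2r.
  by move=> HP HQ; split; [apply: key HP|apply: key HQ];
    rewrite ?normrN ?lerDl ?lerDr.
have near0 (z r : R) : 0 < r -> \forall t \near z, `|t - z| < r.
  by move=> r0; near=> t; rewrite distrC; near: t; exact: nbhsx_ballx.
have s0 (z : R) r : 0 < r -> `|z - z| < r by rewrite subrr normr0.
by split; apply/cvgrPdist_lt => e /main[r r0 rP]; near=> t; rewrite distrC;
  apply rP => //; do ?[exact: s0]; near: t; exact: near0.
Unshelve. all: by end_near. Qed.

Lemma cauchy_riemann_onW a b c d a' b' c' d' : a <= a' -> b' <= b -> c <= c' -> d' <= d ->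
  cauchy_riemann_on a b c d -> cauchy_riemann_on a' b' c' d'.
Proof.
move=> aa bb cc dd CR x y /andP[ax xb] /andP[cy yd].
by apply: CR; apply/andP; split; lra.
Qed.

Lemma cauchy_riemann_on_continuous a b c d : a <= b -> c <= d ->
  cauchy_riemann_on a b c d ->
  (forall x, a <= x <= b -> segment_continuous (P x) c d) /\
  (forall y, c <= y <= d -> segment_continuous (Q^~ y) a b).
Proof.
move=> ab cd CR; split=> [x xab y ycd|y ycd x xab];
  by case: (cauchy_riemann_continuous (CR x y xab ycd)).
Qed.

Lemma boundary_integral_split a b c d m n : a <= m <= b -> c <= n <= d ->
  cauchy_riemann_on a b c d ->
  boundary_integral a b c d =
  boundary_integral a m c n + boundary_integral m b c n
  + (boundary_integral a m n d + boundary_integral m b n d).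
Proof.
move=> /andP[am mb] /andP[cn nd] CR.
have [cP cQ] := cauchy_riemann_on_continuous (le_trans am mb) (le_trans cn nd) CR.
rewrite /boundary_integral.
rewrite (segment_integral_split cn nd (cP b _)); last lra.
rewrite (segment_integral_split cn nd (cP a _)); last lra.
rewrite (segment_integral_split am mb (cQ d _)); last lra.
rewrite (segment_integral_split am mb (cQ c _)); last lra.
ring.
Qed.

(** Affine Cauchy-Riemann pairs have zero boundary integral, so only the error
    terms of the first order expansion contribute. *)
Lemma boundary_integral_local x y e : 0 < e -> cauchy_riemann_at x y ->
  exists2 r, 0 < r & forall a b c d, a <= x <= b -> c <= y <= d ->
    b - a < r -> d - c < r -> cauchy_riemann_on a b c d ->
    `|boundary_integral a b c d| <= 2 * e * ((b - a) + (d - c)) ^+ 2.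
Proof.
move=> e0 [p [q /(_ e e0)[r r0 rP]]]; exists r => // a b c d axb cyd bar dcr CR.
have ab : a <= b by lra. have cd : c <= d by lra.
have [cP cQ] := cauchy_riemann_on_continuous ab cd CR.
set w := b - a; set h := d - c; set M := e * (w + h).
have close x' y' : a <= x' <= b -> c <= y' <= d ->
   `|P x' y' - P x y - (p * (x' - x) + q * (y' - y))| <= M /\
   `|Q x' y' - Q x y - (- q * (x' - x) + p * (y' - y))| <= M.
  move=> x'ab y'cd.
  have x'w : `|x' - x| <= w by rewrite ler_norml /w; apply/andP; split; lra.
  have y'h : `|y' - y| <= h by rewrite ler_norml /h; apply/andP; split; lra.
  have [h1 h2] := rP x' y' (le_lt_trans x'w bar) (le_lt_trans y'h dcr).
  have eM : e * (`|x' - x| + `|y' - y|) <= M by rewrite /M ler_pM2l// lerD.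
  by split; [apply: le_trans h1 _|apply: le_trans h2 _].
have aab : a <= a <= b by lra. have bab : a <= b <= b by lra.
have ccd : c <= c <= d by lra. have dcd : c <= d <= d by lra.
rewrite /boundary_integral -!segment_integralB; do ?[by apply: cP|by apply: cQ].
have H1 := @segment_integral_near R (fun t => P b t - P a t) c d (p * w) (2 * M) cd
   (segment_continuousB (cP _ bab) (cP _ aab)).
have H2 := @segment_integral_near R (fun t => Q t d - Q t c) a b (p * h) (2 * M) ab
   (segment_continuousB (cQ _ dcd) (cQ _ ccd)).
have {}H1 : `|segment_integral (fun t => P b t - P a t) c d - p * w * (d - c)| <= 2 * M * (d - c).
  apply: H1 => t tcd.
  have [+ _] := close b t bab tcd; have [+ _] := close a t aab tcd.
  by rewrite !ler_norml /w => /andP[? ?] /andP[? ?]; apply/andP; split; lra.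
have {}H2 : `|segment_integral (fun t => Q t d - Q t c) a b - p * h * (b - a)| <= 2 * M * (b - a).
  apply: H2 => t tab.
  have [_ +] := close t d tab dcd; have [_ +] := close t c tab ccd.
  by rewrite !ler_norml /h => /andP[? ?] /andP[? ?]; apply/andP; split; lra.
rewrite -/w -/h in H1 H2.
have E : 2 * e * (w + h) ^+ 2 = 2 * M * h + 2 * M * w by rewrite /M; ring.
rewrite E; move: H1 H2; rewrite !ler_norml => /andP[? ?] /andP[? ?].
by apply/andP; split; lra.
Qed.

(** Goursat's theorem: halving the sides keeps a rectangle whose boundary
    integral is at least a quarter of the previous one, while at the limit
    point the boundary integral is negligible compared with the area. *)
Lemma goursat a b c d : a <= b -> c <= d -> cauchy_riemann_on a b c d ->
  boundary_integral a b c d = 0.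
Proof.
move=> ab cd CR; set w := b - a; set h := d - c.
have w0 : 0 <= w by rewrite subr_ge0. have h0 : 0 <= h by rewrite subr_ge0.
apply/eqP; rewrite -normr_le0; apply/ler_addgt0Pr => e' e'0; rewrite add0r.
(* e makes the local bound, summed over all small rectangles, at most e' *)
pose e := e' / (2 * ((w + h) ^+ 2 + 1)).
have D0 : 0 < (w + h) ^+ 2 + 1 by rewrite ltr_wpDl// sqr_ge0.
have e0 : 0 < e by rewrite divr_gt0// mulr_gt0.
suff : `|boundary_integral a b c d| <= 2 * e * (w + h) ^+ 2.
  move=> /le_trans; apply; rewrite /e.
  have -> : 2 * (e' / (2 * ((w + h) ^+ 2 + 1))) * (w + h) ^+ 2 =
     e' * ((w + h) ^+ 2 / ((w + h) ^+ 2 + 1)) by field; lra.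
  by rewrite -[leRHS]mulr1 ler_pM2l// ler_pdivrMr// mul1r lerDl.
pose rw n := w / 2 ^+ n; pose rh n := h / 2 ^+ n.
have rw0 n : 0 <= rw n by rewrite divr_ge0// exprn_ge0.
have rh0 n : 0 <= rh n by rewrite divr_ge0// exprn_ge0.
have rwS n : rw n = rw n.+1 + rw n.+1 by rewrite /rw exprS invfM; lra.
have rhS n : rh n = rh n.+1 + rh n.+1 by rewrite /rh exprS invfM; lra.
pose bad (n : nat) (z : R * R) :=
  [/\ a <= z.1, z.1 + rw n <= b, c <= z.2, z.2 + rh n <= d &
   2 * e * (rw n + rh n) ^+ 2 <
   `|boundary_integral z.1 (z.1 + rw n) z.2 (z.2 + rh n)|].
rewrite leNgt; apply/negP => bad0.
have badS n z : bad n z -> exists z', [/\ bad n.+1 z',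
    z.1 <= z'.1 <= z.1 + rw n.+1 & z.2 <= z'.2 <= z.2 + rh n.+1].
  case: z => x y [/= ax xb cy yd J]; apply/not_existsP => none.
  have small x' y' : x <= x' <= x + rw n.+1 -> y <= y' <= y + rh n.+1 ->
      `|boundary_integral x' (x' + rw n.+1) y' (y' + rh n.+1)| <=
        2 * e * (rw n.+1 + rh n.+1) ^+ 2.
    move=> xx' yy'; rewrite leNgt; apply/negP => J'; apply: (none (x', y')).
    rewrite (rwS n) in xb; rewrite (rhS n) in yd.
    by split => //; split => //=; lra.
  move: J; apply/negP; rewrite -leNgt.
  have rwn := rw0 n.+1; have rhn := rh0 n.+1.
  rewrite (rwS n) (rhS n) in xb yd *.
  rewrite (addrA x) (addrA y) in xb yd *.
  rewrite (@boundary_integral_split _ _ _ _ (x + rw n.+1) (y + rh n.+1)); [| lra | lra |].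
    have x1 : x <= x <= x + rw n.+1 by lra.
    have x2 : x <= x + rw n.+1 <= x + rw n.+1 by lra.
    have y1 : y <= y <= y + rh n.+1 by lra.
    have y2 : y <= y + rh n.+1 <= y + rh n.+1 by lra.
    have j1 := small _ _ x1 y1; have j2 := small _ _ x2 y1.
    have j3 := small _ _ x1 y2; have j4 := small _ _ x2 y2.
    apply: le_trans (ler_normD _ _) _.
    apply: le_trans (lerD (ler_normD _ _) (ler_normD _ _)) _.
    set u := rw n.+1 in j1 j2 j3 j4 *; set v := rh n.+1 in j1 j2 j3 j4 *.
    have -> : 2 * e * (u + u + (v + v)) ^+ 2 = 4 * (2 * e * (u + v) ^+ 2) by ring.
    lra.
  by apply: cauchy_riemann_onW CR; lra.
have [z z0 zP] : exists2 z : nat -> R * R, z 0%N = (a, c) & forall n,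
   [/\ bad n (z n), (z n).1 <= (z n.+1).1 <= (z n).1 + rw n.+1 &
     (z n).2 <= (z n.+1).2 <= (z n).2 + rh n.+1].
  have /choice[f fP] : forall nz : nat * (R * R), exists z', bad nz.1 nz.2 ->
      [/\ bad nz.1.+1 z', nz.2.1 <= z'.1 <= nz.2.1 + rw nz.1.+1
        & nz.2.2 <= z'.2 <= nz.2.2 + rh nz.1.+1].
    move=> [n z]; have [/badS[z' ?]|nbad] := pselect (bad n z); first by exists z'.
    by exists z.
  pose z := fix z n := if n is n'.+1 then f (n', z n') else (a, c).
  have zbad n : bad n (z n).
    elim: n => [|n IH].
      rewrite /z /= /bad /= /rw /rh expr0 !divr1.
      by split; rewrite /w /h ?subrKC //; move: bad0; rewrite /w /h.
    by have [] := fP (n, z n) IH.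
  exists z => // n; split; first exact: zbad.
    by have [] := fP (n, z n) (zbad n).
  by have [] := fP (n, z n) (zbad n).
have [X XP] : exists X, forall n, (z n).1 <= X <= (z n).1 + rw n.
  by apply: nested_dyadic => // n; case: (zP n).
have [Y YP] : exists Y, forall n, (z n).2 <= Y <= (z n).2 + rh n.
  by apply: nested_dyadic => // n; case: (zP n).
have CRXY : cauchy_riemann_at X Y.
  apply: CR; [have := XP 0%N|have := YP 0%N]; rewrite z0 /= /rw /rh expr0 !divr1 /w /h; lra.
have [r r0 rP] := boundary_integral_local e0 CRXY.
have [n1 n1P] := dyadic_small (addr_ge0 w0 h0) r0.
have [[z1a z1b z2c z2d] + _ _] := zP n1.
apply/negP; rewrite -leNgt.
have wn := rw0 n1; have hn := rh0 n1.
have whr : rw n1 + rh n1 < r by rewrite /rw /rh -mulrDl.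
have := rP (z n1).1 ((z n1).1 + rw n1) (z n1).2 ((z n1).2 + rh n1) (XP n1) (YP n1).
rewrite ![_ + _ - _]addrC !addKr; apply; do ?lra.
by apply: cauchy_riemann_onW CR; lra.
Qed.

End Goursat.

(** * The mean value property *)

Section MeanValue.
Context {R : realType}.
Local Notation C := (R[i]^o).

Lemma is_derive_expansion (f : R -> R) (x l : R) : is_derive x (1 : R) f l ->
  forall e : R, 0 < e -> exists2 d : R, 0 < d &
  forall u, `|u| < d -> `|f (x + u) - f x - l * u| <= e * `|u|.
Proof.
move=> [df <-] e e0; have /cvgrPdist_lt/(_ e e0) := df.
rewrite /dnbhs near_withinE => /nbhs_ballP[d /= d0 fd].
exists d => // u ud; have [->|u0] := eqVneq u 0.
  by rewrite addr0 subrr mulr0 subr0 normr0 mulr0.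
have := fd u; rewrite /ball /= sub0r normrN => /(_ ud u0) /ltW.
rewrite -[_ *: 1]/(u * 1) mulr1 (addrC u).
rewrite -[u^-1 *: _]/(u^-1 * _) /derive; set D := lim _ => fdu.
have -> : f (x + u) - f x - D * u = - (D - u^-1 * (f (x + u) - f x)) * u by field.
by rewrite normrM normrN ler_wpM2r.
Qed.

(** The complex exponential [exp (x + i y)], that is, logarithmic polar
    coordinates. *)
Definition cexp (x y : R) : C := Complex (expR x * cos y) (expR x * sin y).

Lemma cexpD x y u v : cexp (x + u) (y + v) = cexp x y * cexp u v.
Proof.
by apply/eqP; rewrite eq_complex /= expRD cosD sinD; apply/andP; split; apply/eqP; ring.
Qed.

Lemma modulus_cexp x y : modulus (cexp x y) = expR x.
Proof.
by rewrite /modulus /= !exprMn -mulrDr cos2Dsin2 mulr1 sqrtr_sqr ger0_norm ?expR_ge0.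
Qed.

Lemma cexp_expansion0 (e : R) : 0 < e -> exists2 d : R, 0 < d &
  forall u v, `|u| < d -> `|v| < d ->
    modulus (cexp u v - 1 - Complex u v) <= e * (`|u| + `|v|).
Proof.
move=> e0; pose e1 := e / 6.
have e10 : 0 < e1 by rewrite divr_gt0.
have [d1 d10 E1] := is_derive_expansion (is_derive_expR (0 : R)) e10.
have [d2 d20 E2] := is_derive_expansion (is_derive_cos (0 : R)) e10.
have [d3 d30 E3] := is_derive_expansion (is_derive_sin (0 : R)) e10.
exists (Order.min (Order.min d1 d2) (Order.min d3 (Order.min 1 e1))).
  by rewrite !lt_min d10 d20 d30 e10 ltr01.
move=> u v; rewrite !lt_min => /and3P[/andP[u1 u2] u3 /andP[u4 u5]].
move=> /and3P[/andP[v1 v2] v3 /andP[v4 v5]].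
have := E1 _ u1; have := E2 _ v2; have := E3 _ v3.
rewrite !add0r expR0 cos0 sin0 oppr0 mul0r ?subr0 ?addr0 !mul1r => {E1 E2 E3} E3 E2 E1.
apply: le_trans (modulus_le _) _.
rewrite !ReD !ImD !ReN !ImN /= oppr0 !addr0.
have -> : expR u * cos v - 1 - u = (expR u - 1 - u) * cos v + (1 + u) * (cos v - 1) by ring.
have -> : expR u * sin v - v = (expR u - 1 - u) * sin v + (1 + u) * (sin v - v) + u * v by ring.
have cv := cos_max v; have sv := sin_max v.
have u2' : `|1 + u| <= 2.
  by apply: le_trans (ler_normD _ _) _; rewrite normr1; lra.
have bound (a b c d : R) : `|a| <= c -> `|b| <= d -> `|a * b| <= c * d.
  by move=> ac bd; rewrite normrM ler_pM.
have B1 := bound _ _ _ _ E1 cv; have B2 := bound _ _ _ _ u2' E2.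
have B3 := bound _ _ _ _ E1 sv; have B4 := bound _ _ _ _ u2' E3.
have B5 := bound _ _ _ _ (lexx `|u|) (ltW v5).
apply: le_trans (lerD (ler_normD _ _) (le_trans (ler_normD _ _) (lerD (ler_normD _ _) (lexx _)))) _.
have ev : 0 <= e1 * `|v| by rewrite mulr_ge0// ltW.
have eu : 0 <= e1 * `|u| by rewrite mulr_ge0// ltW.
have -> : e * (`|u| + `|v|) = 6 * (e1 * `|u|) + 6 * (e1 * `|v|) by rewrite /e1; field.
lra.
Qed.

Lemma cexp_expansion x y (e : R) : 0 < e -> exists2 d : R, 0 < d &
  forall u v, `|u| < d -> `|v| < d ->
    modulus (cexp (x + u) (y + v) - cexp x y - cexp x y * Complex u v) <=
      e * (`|u| + `|v|).
Proof.
move=> e0; have ex := expR_gt0 x.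
have [d d0 dP] := cexp_expansion0 (divr_gt0 e0 ex).
exists d => // u v ud vd; rewrite cexpD.
have -> : cexp x y * cexp u v - cexp x y - cexp x y * Complex u v =
   cexp x y * (cexp u v - 1 - Complex u v) by ring.
rewrite modulusM modulus_cexp mulrC -ler_pdivlMr// mulrAC.
exact: dP.
Qed.

Lemma circle_point_cexp (z : C) x y : circle_point z (expR x) y = z + cexp x y.
Proof. by []. Qed.

Lemma modulus_circle_point (z : C) (r t : R) : 0 <= r ->
  modulus (circle_point z r t - z) = r.
Proof.
move=> r0; rewrite /circle_point [z + _]addrC addrK /modulus /= !exprMn -mulrDr.
by rewrite cos2Dsin2 mulr1 sqrtr_sqr ger0_norm.
Qed.

(** Logarithmic polar coordinates are conformal, so a holomorphic function
    stays a solution of the Cauchy-Riemann equations in them. *)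
Lemma cauchy_riemann_cexp (f : C -> C) (z : C) x y :
  derivable f (z + cexp x y) 1 ->
  cauchy_riemann_at (fun x y => Re (f (z + cexp x y)))
    (fun x y => Im (f (z + cexp x y))) x y.
Proof.
move=> df; set w := z + cexp x y in df *; pose l := 'D_1 f w.
pose L := l * cexp x y.
exists (Re L), (- Im L) => e e0; rewrite opprK.
(* half of e goes to the expansion of f, half to that of the exponential *)
pose K := modulus (cexp x y) + 1; pose e1 := e / (2 * K); pose e2 := e / (2 * (modulus l + 1)).
have K0 : 0 < K by rewrite ltr_wpDl// modulus_ge0.
have l0 : 0 < modulus l + 1 by rewrite ltr_wpDl// modulus_ge0.
have e10 : 0 < e1 by rewrite divr_gt0// mulr_gt0.
have e20 : 0 < e2 by rewrite divr_gt0// mulr_gt0.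
have [d1 d10 E1] := derivable_expansion df e10.
have e30 : 0 < Order.min e2 (1/2) by rewrite lt_min e20 divr_gt0.
have [d2 d20 E2] := cexp_expansion x y e30.
have K20 : 0 < d1 / (2 * K) by rewrite divr_gt0// mulr_gt0.
exists (Order.min d2 (d1 / (2 * K))); first by rewrite lt_min d20 K20.
move=> x' y'; rewrite !lt_min; set u := x' - x; set v := y' - y.
move=> /andP[ud2 ud1] /andP[vd2 vd1].
have := E2 u v ud2 vd2; rewrite (addrC x) (addrC y) !subrK.
set D := cexp x' y' - cexp x y; set h : C := Complex u v.
set s := `|u| + `|v|; move=> Dh.
have s0 : 0 <= s by rewrite addr_ge0.
have hs : modulus h <= s by exact: modulus_le.
have Dh1 : modulus (D - cexp x y * h) <= e2 * s.
  by apply: le_trans Dh _; rewrite ler_wpM2r// ge_min lexx.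
have Dh2 : modulus (D - cexp x y * h) <= s.
  apply: le_trans Dh _; rewrite -[leRHS]mul1r ler_wpM2r// ge_min.
  by apply/orP; right; lra.
have DK : modulus D <= K * s.
  rewrite -(subrK (cexp x y * h) D); apply: le_trans (modulusD _ _) _.
  rewrite modulusM /K mulrDl mul1r addrC lerD// ler_wpM2l// modulus_ge0//.
have DE : z + cexp x' y' - w = D by rewrite /w /D opprD addrACA subrr add0r.
have Dd1 : modulus (z + cexp x' y' - w) < d1.
  rewrite DE; apply: le_lt_trans DK _.
  rewrite ltr_pdivlMr ?mulr_gt0// in ud1; rewrite ltr_pdivlMr ?mulr_gt0// in vd1.
  by rewrite mulrC /s; lra.
have := E1 _ Dd1; rewrite DE -/l => fw.
have fin : modulus (f (z + cexp x' y') - f w - L * h) <= e * s.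
  have -> : f (z + cexp x' y') - f w - L * h =
     (f (z + cexp x' y') - f w - l * D) + l * (D - cexp x y * h).
    by rewrite /L; ring.
  apply: le_trans (modulusD _ _) _; rewrite modulusM.
  have h1 : e1 * modulus D <= e / 2 * s.
    have -> : e / 2 * s = e1 * (K * s) by rewrite /e1; field; lra.
    by rewrite ler_pM2l.
  have h2 : modulus l * modulus (D - cexp x y * h) <= e / 2 * s.
    apply: le_trans (_ : (modulus l + 1) * (e2 * s) <= _); last first.
      have -> // : (modulus l + 1) * (e2 * s) = e / 2 * s by rewrite /e2; field; lra.
    by rewrite ler_pM ?modulus_ge0// lerDl.
  rewrite [leRHS](_ : _ = e / 2 * s + e / 2 * s); last by field.
  by rewrite lerD// (le_trans fw).
split.
- apply: le_trans fin; apply: le_trans (le_Re_modulus _).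
  by rewrite !(ReD, ReN, ReM) /= mulNr.
- apply: le_trans fin; apply: le_trans (le_Im_modulus _).
  by rewrite ImD ImN (ImM L h) ImD ImN (addrC (Re L * Im h)).
Qed.

(** The mean value property. Goursat's theorem in logarithmic polar coordinates
    shows that the mean over a circle does not depend on its radius. *)
Lemma mean_value_property (f : C -> C) (z : C) (rho : R) :
  (forall w, modulus (w - z) < rho -> derivable f w 1) ->
  forall r, 0 < r < rho ->
  segment_continuous (fun t => Re (f (circle_point z r t))) 0 (2 * pi) /\
  segment_integral (fun t => Re (f (circle_point z r t))) 0 (2 * pi) = 2 * pi * Re (f z).
Proof.
move=> df r /andP[r0 rrho].
have pi20 : 0 <= 2 * pi :> R by rewrite mulr_ge0// pi_ge0.
pose P x y := Re (f (z + cexp x y)); pose Q x y := Im (f (z + cexp x y)).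
have CR x y : x <= ln r -> cauchy_riemann_at P Q x y.
  move=> xr; apply: cauchy_riemann_cexp; apply: df.
  rewrite addrC addKr modulus_cexp (le_lt_trans _ rrho)//.
  by rewrite -[leRHS]lnK ?ler_expR.
have PE t : P (ln r) t = Re (f (circle_point z r t)).
  by rewrite /P -circle_point_cexp lnK.
have mean_cst x : x <= ln r -> segment_integral (P x) 0 (2 * pi) =
    segment_integral (P (ln r)) 0 (2 * pi).
  move=> xr; have := @goursat R P Q x (ln r) 0 (2 * pi) xr pi20.
  rewrite /boundary_integral (_ : Q^~ (2 * pi) = Q^~ 0).
    rewrite (subrr (segment_integral (Q^~ 0) x (ln r))) subr0 => J; apply/eqP; rewrite eq_sym -subr_eq0; apply/eqP.
    by apply: J => x' y' /andP[_ x'r] _; exact: CR.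
  apply/funext => x' /=; rewrite /Q /cexp.
  by rewrite -[2 * pi]add0r mulr_natl cosD2pi sinD2pi.
have contP x : x <= ln r -> segment_continuous (P x) 0 (2 * pi).
  by move=> xr y _; case: (cauchy_riemann_continuous (CR x y xr)).
have -> : (fun t => Re (f (circle_point z r t))) = P (ln r).
  by apply/funext => t; rewrite PE.
split; first exact: contP.
(* the common value of the means is found by letting the radius tend to 0 *)
apply/eqP; rewrite -subr_eq0 -normr_le0; apply/ler_addgt0Pr => e e0; rewrite add0r.
have fz : derivable f z 1 by apply: df; rewrite subrr modulus0; lra.
have fcont : {for z, continuous f}.
  by apply: differentiable_continuous; exact/derivable1_diffP.
pose e1 := e / (2 * pi + 1).
have e10 : 0 < e1 by rewrite divr_gt0// ltr_wpDl.
have /continuousCP/(_ _ e10)/near_modulus[d d0 fd] := fcont.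
pose x := Order.min (ln r) (ln (d / 2)).
have xr : x <= ln r by rewrite ge_min lexx.
rewrite -(mean_cst x xr).
have d20 : 0 < d / 2 by rewrite divr_gt0.
have xd : expR x < d.
  apply: le_lt_trans (_ : d / 2 < _); last lra.
  by rewrite -[leRHS]lnK ?ler_expR// ge_min lexx orbT.
have := @segment_integral_near R (P x) 0 (2 * pi) (Re (f z)) e1 pi20 (contP x xr).
rewrite subr0 [Re _ * _]mulrC => /(_ _)/le_trans; apply.
  move=> t _; rewrite /P -ReN -ReD; apply: le_trans (le_Re_modulus _) _.
  by apply/ltW/fd; rewrite addrC addKr modulus_cexp.
rewrite /e1 mulrAC ler_pdivrMr ?ltr_wpDl// ler_pM2l// lerDl.
exact: ler01.
Qed.

End MeanValue.

(** * The maximum principle *)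

Section MaximumPrinciple.
Context {R : realType}.
Local Notation C := (R[i]^o).
Local Open Scope ereal_scope.

(** Comparison through simple functions, so that it covers a subharmonic
    function along a circle, whose measurability would have to be proved. *)
Lemma integral_mono d (T : measurableType d) (mu : {measure set T -> \bar R})
    (D : set T) (f g : T -> \bar R) :
  (forall x, D x -> f x <= g x) -> \int[mu]_(x in D) f x <= \int[mu]_(x in D) g x.
Proof.
move=> fg.
have rfg : forall x, (f \_ D) x <= (g \_ D) x by move=> x; exact: lee_restrict.
rewrite /integral; apply: leeB; apply: le_ereal_sup => _ /= [h hf <-];
  exists h => // x; apply: le_trans (hf x) _.
- by rewrite !funeposE ge_max le_max rfg /= le_max lexx orbT.
- by rewrite !funenegE ge_max le_max leeN2 rfg /= le_max lexx orbT.
Qed.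

Lemma limf_esup_within_leP (T : topologicalType) (u : T -> \bar R) (O : set T) (z : T) (a : R) :
  limf_esup u (within O (nbhs z)) <= a%:E <->
  forall e : R, (0 < e)%R -> \forall w \near z, O w -> u w <= (a + e)%:E.
Proof.
split=> [ua e e0|ua].
  have : limf_esup u (within O (nbhs z)) < (a + e)%:E.
    by rewrite (le_lt_trans ua)// lte_fin ltrDl.
  rewrite limf_esupE => /ereal_inf_lt[_ [V FV <-] Vae].
  rewrite /within /= in FV; near=> w => Ow; apply: le_trans (ltW Vae).
  apply: ereal_sup_ubound; exists w => //.
  by move: Ow; near: w.
apply/lee_addgt0Pr => e e0; rewrite limf_esupE.
apply: le_trans (_ : ereal_sup (u @` [set w | u w <= (a + e)%:E]) <= _).
  by apply: ereal_inf_lbound; exists [set w | u w <= (a + e)%:E] => //; exact: ua.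
by apply: ge_ereal_sup => _ [w /= uw <-].
Unshelve. all: by end_near. Qed.

Lemma segment_integral_EFin (f : R -> R) (a b : R) : segment_continuous f a b ->
  \int[@lebesgue_measure R]_(x in `[a, b]) (f x)%:E = (segment_integral f a b)%:E.
Proof.
move=> /segment_integrable fi; rewrite /segment_integral /Rintegral fineK//.
exact: integrable_fin_num.
Qed.

(** The class of test functions is the real parts of holomorphic functions.
    Adding a small multiple of the squared modulus to [v - Re q] makes an
    interior maximum impossible: along a small circle this square has mean
    larger than its central value, while the submean inequality for [v] and the
    mean value property of [q] balance. *)
Lemma maximum_principle (O : set C) (v : C -> \bar R) (q : C -> C) (M : R) :
  open O -> (forall z, O z -> (modulus z <= M)%R) ->
  subharmonic O v -> holomorphic_on O q ->
  (forall zeta, boundary O zeta -> forall e : R, (0 < e)%R ->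
     \forall w \near zeta, O w -> v w <= (Re (q w) + e)%:E) ->
  forall z, O z -> v z <= (Re (q z))%:E.
Proof.
move=> oO OM sv hq bd z0 Oz0; rewrite leNgt; apply/negP => qv.
have M0 : (0 <= M)%R by apply: le_trans (OM _ Oz0); exact: modulus_ge0.
have v0fin : v z0 \is a fin_num.
  have [vy _ _] := sv _ Oz0.
  by rewrite fin_real// vy andbT (lt_trans (ltNyr _) qv).
have [g g0 gE] : exists2 g : R, (0 < g)%R & v z0 = (Re (q z0) + g)%:E.
  exists (fine (v z0) - Re (q z0))%R; last by rewrite subrKC fineK.
  by rewrite subr_gt0 -lte_fin fineK.
pose eta : R := (g / (4 * (M ^+ 2 + 1)))%R.
have M20 : (0 < M ^+ 2 + 1)%R by rewrite ltr_wpDl// sqr_ge0.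
have eta0 : (0 < eta)%R by rewrite divr_gt0// mulr_gt0.
pose s (z : C) : R := (eta * modulus z ^+ 2 - Re (q z))%R.
pose Phi (z : C) := v z + (s z)%:E.
have etaM z : O z -> (eta * modulus z ^+ 2 <= g / 4)%R.
  move=> Oz; have zM : (modulus z ^+ 2 <= M ^+ 2)%R.
    by rewrite ler_pXn2r ?nnegrE ?modulus_ge0 ?OM.
  rewrite /eta mulrAC ler_pdivrMr ?mulr_gt0//.
  rewrite [leRHS](_ : _ = g * (M ^+ 2 + 1))%R; last by field.
  by rewrite ler_pM2l//; apply: le_trans zM _; rewrite lerDl.
have Phi0 : g%:E <= Phi z0.
  rewrite /Phi gE -EFinD lee_fin /s.
  by have := mulr_ge0 (ltW eta0) (sqr_ge0 (modulus z0)); lra.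
have s_cont z : O z -> {for z, continuous s}.
  move=> Oz.
  have qz : {for z, continuous q}.
    by apply: differentiable_continuous; apply/derivable1_diffP; exact: hq.
  have mz : {for z, continuous (@modulus R)}.
    apply: continuousCR => e e0; exists e => // w wz.
    apply: le_lt_trans wz; rewrite ler_norml.
    have := modulus_triangle w z 0; have := modulus_triangle z w 0.
    by rewrite !subr0 (modulusB z w) => ? ?; apply/andP; split; lra.
  have qR : Re (q w) @[w --> z] --> Re (q z).
    by apply: (@cvg_comp _ _ _ q (fun x : C => Re x) _ (nbhs (q z))) => //; exact: Re_continuous.
  have mz2 : (modulus w ^+ 2)%R @[w --> z] --> (modulus z ^+ 2)%R.
    exact: (@cvgM R C (nbhs z) (@nbhs_filter C z) _ _ _ _ mz mz).
  apply: (@cvgB R R C (nbhs z) (@nbhs_filter C z)) => //.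
  by apply: (@cvgM R C (nbhs z) (@nbhs_filter C z)) => //; exact: cvg_cst.
(* upper semicontinuity of Phi on the closure, the boundary values being low *)
have locbd z (T : \bar R) : (g / 2)%:E < T -> (O z -> Phi z < T) ->
    exists2 c : R, c%:E < T & \forall w \near z, O w -> Phi w <= c%:E.
  move=> gT PhiT; have [Oz|nOz] := pselect (O z).
    have {}PhiT := PhiT Oz.
    have [c [Phic cT]] : exists c : R, Phi z < c%:E /\ c%:E < T.
      have [vy _ _] := sv _ Oz; move: PhiT gT; rewrite /Phi.
      case: T => [t||] //; last first.
        move=> _ _; case: (v z) vy => [r||] // _.
          by exists (r + s z + 1)%R; rewrite -EFinD lte_fin ltrDl ltry.
        by exists 0%R; rewrite addNye ltNyr ltry.
      move=> PhiT _; case: (v z) vy PhiT => [r||] // _.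
        rewrite -EFinD lte_fin => rt.
        by exists ((r + s z + t) / 2)%R; rewrite !lte_fin; split; lra.
      by exists (t - 1)%R; rewrite addNye ltNyr lte_fin gtrBl.
    exists c => //.
    (* split the gap between v and s *)
    have [r vr rc] : exists2 r : R, v z < r%:E & (r + s z < c)%R.
      move: Phic; rewrite /Phi; have [vy _ _] := sv _ Oz.
      case: (v z) vy => [r||] // _; last first.
        by move=> _; exists (c - s z - 1)%R; [exact: ltNyr|lra].
      rewrite -EFinD lte_fin => rc.
      by exists ((r + c - s z) / 2)%R; [rewrite lte_fin|]; lra.
    have [_ usc _] := sv _ Oz.
    have sc : \forall w \near z, (s w < c - r)%R.
      have /(@cvgrPdist_lt R R C (nbhs z) _ s (s z))/(_ (c - r - s z)%R) := s_cont z Oz.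
      rewrite subr_gt0 ltrBrDl => /(_ rc) sw; near=> w.
      have : (`|s z - s w| < c - r - s z)%R by near: w.
      by rewrite ltr_norml => /andP[? ?]; lra.
    near=> w => Ow.
    have vw : v w < r%:E by near: w; exact: usc.
    have sw : (s w < c - r)%R by near: w.
    rewrite /Phi; apply: le_trans (leeD (ltW vw) (lexx _)) _.
    by rewrite -EFinD lee_fin; lra.
  exists (g / 2)%R => //.
  have [clz|nclz] := pselect (closure O z).
    have bz : boundary O z by split => //; rewrite (interior_id _).1.
    have g4 : (0 < g / 4)%R by rewrite divr_gt0.
    have := bd z bz _ g4; apply: filterS => w h Ow.
    rewrite /Phi; apply: le_trans (leeD (h Ow) (lexx _)) _.
    by rewrite -EFinD lee_fin /s; have := etaM w Ow; lra.
  have : nbhs z (~` closure O) by apply: open_nbhs_nbhs; split => //; exact/closed_openC/closed_closure.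
  by apply: filterS => w nw Ow; exfalso; apply: nw; exact: subset_closure.
have cK : compact [set z : C | (modulus z <= M)%R].
  apply: (@bounded_closed_compactC R _ M) => //.
  rewrite (_ : mkset _ = [set z : C | (modulus (z - 0) <= M)%R]).
    exact: closed_modulus.
  by apply/seteqP; split => w /=; rewrite subr0.
have Og z : O z -> [set z : C | (modulus z <= M)%R] z by exact: OM.
(* a bound by T at every point gives, by compactness, a uniform bound that is
   smaller than T; used for T = +oo and then for the supremum of Phi *)
have cover (T : \bar R) (F : set_system R) : Filter F ->
    (forall c : R, c%:E < T -> \forall t \near F, (c <= t)%R) ->
    (g / 2)%:E < T -> (forall z, O z -> Phi z < T) ->
    \forall t \near F, forall z, O z -> Phi z <= t%:E.
  move=> FF FT gT PhiT.
  have /compact_near_coveringP := cK.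
  move=> /(_ R F (fun t z => O z -> Phi z <= t%:E) FF).
  have H z : [set z : C | (modulus z <= M)%R] z ->
    \forall w \near z & t \near F, O w -> Phi w <= t%:E.
    move=> _; have [c cT wc] := locbd z T gT (PhiT z).
    exists ([set w | O w -> Phi w <= c%:E], [set t | (c <= t)%R]) => /=.
      by split => //; exact: FT.
    move=> [w t] /= [h ct] Ow; apply: le_trans (h Ow) _.
    by rewrite lee_fin.
  move=> /(_ H); apply: filterS => t h z Oz; apply: h => //; exact: OM.
have g2g : (g / 2 < g)%R by lra.
have [S PhiS] : exists S : R, S%:E = ereal_sup (Phi @` O).
  have bdd : exists t : R, forall z, O z -> Phi z <= t%:E.
    have h1 (c : R) : c%:E < +oo -> \forall t \near pinfty_nbhs R, (c <= t)%R.
      by move=> _; exact/nbhs_pinfty_ge/num_real.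
    have h2 z : O z -> Phi z < +oo.
      by move=> Oz; have [vy _ _] := sv _ Oz; rewrite /Phi lte_add_pinfty// ltry.
    have FF : Filter (pinfty_nbhs R) by exact: _.
    by have /filter_ex := @cover +oo (pinfty_nbhs R) FF h1 (ltry _) h2.
  have [t tP] := bdd; exists (fine (ereal_sup (Phi @` O))).
  rewrite fineK// fin_real//; apply/andP; split.
    apply: lt_le_trans (ltNyr g) (le_trans Phi0 _).
    by apply: ereal_sup_ubound; exists z0.
  apply: le_lt_trans (ltry t); apply: ge_ereal_sup => _ [z Oz <-]; exact: tP.
have leS z : O z -> Phi z <= S%:E by move=> Oz; rewrite PhiS; apply: ereal_sup_ubound; exists z.
have gS : (g <= S)%R by rewrite -lee_fin (le_trans Phi0)// leS.
have [z1 Oz1 z1S] : exists2 z1, O z1 & Phi z1 = S%:E.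
  apply: contrapT => none.
  have lt z : O z -> Phi z < S%:E.
    move=> Oz; rewrite lt_neqAle leS// andbT; apply/eqP => zS.
    by apply: none; exists z.
  have h1 (c : R) : c%:E < S%:E -> \forall t \near S^'-, (c <= t)%R.
    by rewrite lte_fin => cS; near=> t; apply/ltW; near: t; exact: nbhs_left_gt.
  have gS2 : (g / 2)%:E < S%:E by rewrite lte_fin; lra.
  have FF : Filter S^'- by exact: _.
  have := @cover S%:E (S^'-) FF h1 gS2 lt.
  have tS : \forall t \near S^'-, (t < S)%R by exact: nbhs_left_lt.
  move=> /(filterI tS) /filter_ex[t [/= tltS tP]].
  have : S%:E <= t%:E by rewrite PhiS; apply: ge_ereal_sup => _ [z Oz <-]; exact: tP.
  by rewrite lee_fin leNgt tltS.
(* on O the function v stays below a perturbation of Re q, touching it at z1 *)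
have vle z : O z -> v z <= (S + Re (q z) - eta * modulus z ^+ 2)%:E.
  move=> /leS; rewrite /Phi -leeBrDr// => /le_trans; apply.
  by rewrite -EFinB lee_fin /s; lra.
have vz1 : v z1 = (S + Re (q z1) - eta * modulus z1 ^+ 2)%:E.
  move: z1S; rewrite /Phi => z1S.
  by rewrite -(@addeK _ (s z1)%:E (v z1))// z1S -EFinB /s; congr EFin; lra.
have [_ _ [rho rho0 smean]] := sv _ Oz1.
have /nbhs_modulusP[d d0 dO] : nbhs z1 O by exact: open_nbhs_nbhs.
pose r := (Order.min rho d / 2)%R.
have md0 : (0 < Order.min rho d)%R by rewrite lt_min rho0 d0.
have r0 : (0 < r)%R by rewrite divr_gt0.
have rmd : (r < Order.min rho d)%R by rewrite /r; lra.
have [rrho rd] : (r < rho)%R /\ (r < d)%R by move: rmd; rewrite lt_min => /andP[].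
have := smean r; rewrite r0 rrho => /(_ isT); apply/negP; rewrite -ltNge.
(* on the circle [|z|^2 = |z1|^2 + 2 Re (conj z1 (z - z1)) + r^2], so the upper
   bound of v is there the real part of the holomorphic function q2 *)
pose k : C := (S - eta * modulus z1 ^+ 2 - eta * r ^+ 2)%:C%R.
pose q2 (z : C) : C := (k + q z - (2 * eta)%:C * conjc z1 * (z - z1))%R.
have hq2 w : (modulus (w - z1) < d)%R -> derivable q2 w 1.
  move=> wd; apply: derivableB; first apply: derivableD; first exact: derivable_cst.
    by apply: hq; exact: dO.
  apply: derivableM; first exact: derivable_cst.
  by apply: derivableB; [exact: derivable_id|exact: derivable_cst].
have r0d : (0 < r < d)%R by rewrite r0.
have [cq2 mq2] := mean_value_property hq2 r0d.
apply: le_lt_trans (_ : _ <= (2 * pi)^-1%:E *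
   \int[@lebesgue_measure R]_(t in `[0%R, (2 * pi)%R]) (Re (q2 (circle_point z1 r t)))%:E) _.
  apply: lee_wpmul2l; first by rewrite lee_fin invr_ge0 mulr_ge0// pi_ge0.
  apply: integral_mono => t _.
  have cr := modulus_circle_point z1 t (ltW r0).
  have Ocp : O (circle_point z1 r t) by apply: dO; rewrite cr.
  apply: le_trans (vle _ Ocp) _; rewrite lee_fin.
  set w := circle_point z1 r t in cr *.
  rewrite /q2 !(ReD, ReN) /=.
  have : (modulus w ^+ 2 = modulus z1 ^+ 2 + 2 * Re (conjc z1 * (w - z1)) + r ^+ 2)%R.
    rewrite -cr !modulus_sqr !(ReD, ReN, ReM, ImD, ImN).
    by case: (z1) => a b /=; ring.
  by move=> ->; rewrite -mulrA (ReM (2 * eta)%:C) /= mul0r subr0; lra.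
rewrite segment_integral_EFin// mq2 -EFinM vz1 lte_fin.
rewrite /q2 subrr mulr0 subr0 !ReD /= mulrA mulVf ?mul1r; last first.
  by rewrite gt_eqF// mulr_gt0// pi_gt0.
have := mulr_gt0 eta0 (exprn_gt0 2 r0); lra.
Unshelve. all: by end_near. Qed.

End MaximumPrinciple.

(** * The Fejer kernel *)

Section FejerKernel.
Context {R : realType}.
Local Notation C := (R[i]^o).

Lemma Re_sum (I : Type) (r : seq I) (F : I -> C) :
  Re (\sum_(i <- r) F i) = \sum_(i <- r) Re (F i).
Proof. exact: (big_morph _ ReD (erefl _)). Qed.

Lemma cexp0X t k : (cexp 0 t : C) ^+ k = cexp 0 (t *+ k) :> C.
Proof.
elim: k => [|k IH]; first by rewrite expr0 mulr0n /cexp expR0 cos0 sin0 mulr1 mulr0.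
by rewrite exprS IH -cexpD addr0 mulrS.
Qed.

(** The sum of all the powers [zeta ^ |j - l|] with [j, l < N]; on the unit
    circle its real part is [N] times the Fejer kernel, and as a function of
    [zeta] it is a polynomial. *)
Definition fejer (N : nat) (zeta : C) : C :=
  \sum_(j < N) \sum_(l < N) zeta ^+ (j - l + (l - j)).

Lemma Re_fejer N t : Re (fejer N (cexp 0 t)) =
  modulus (\sum_(j < N) (cexp 0 t : C) ^+ j) ^+ 2.
Proof.
set z : C := cexp 0 t; set S := \sum_(j < N) z ^+ j.
have zz : z * conjc z = 1.
  apply/eqP; rewrite eq_complex /z /cexp /= expR0 !mul1r mulrN opprK -!expr2.
  by rewrite cos2Dsin2 eqxx mulrN mulrC addNr eqxx.
clearbody z; have -> : modulus S ^+ 2 = Re (S * conjc S).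
  by rewrite modulus_sqr ReM; case: (S) => a b /=; ring.
have -> : conjc S = \sum_(l < N) conjc z ^+ l.
  by rewrite /S rmorph_sum; apply: eq_bigr => l _; rewrite rmorphXn.
rewrite big_distrlr /= /fejer !Re_sum; apply: eq_bigr => j _.
rewrite !Re_sum; apply: eq_bigr => l _.
have [lj|/ltnW jl] := leqP l j.
  rewrite -[in RHS](subnK lj) [in RHS]exprD -mulrA -exprMn zz expr1n mulr1.
  by rewrite (eqP lj) addn0.
rewrite -[in RHS](subnK jl) [in RHS]exprD mulrCA -exprMn zz expr1n mulr1.
rewrite (eqP jl) add0n -(rmorphXn (@conjc R)).
by case: (z ^+ _).
Qed.

Lemma Re_fejer_ge0 N t : 0 <= Re (fejer N (cexp 0 t)).
Proof. by rewrite Re_fejer sqr_ge0. Qed.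

(** The kernel concentrates at [t = 0]: the sum of the geometric progression
    is at most [2 / |1 - zeta|]. *)
Lemma Re_fejer_le N t : Re (fejer N (cexp 0 t)) * (1 - cos t) <= 2.
Proof.
rewrite Re_fejer; set z : C := cexp 0 t; set S := \sum_(j < N) z ^+ j.
have m1 : modulus (z - 1) ^+ 2 = 2 * (1 - cos t).
  rewrite modulus_sqr ReD ImD ReN ImN /z /cexp /= expR0 !mul1r oppr0 addr0.
  by have := cos2Dsin2 t => h; rewrite sqrrB expr1n mulr1; lra.
have m2 : modulus (z ^+ N - 1) ^+ 2 <= 4.
  rewrite [leRHS](_ : _ = 2 ^+ 2); last by rewrite expr2; lra.
  rewrite ler_pXn2r ?nnegrE ?modulus_ge0//; apply: le_trans (modulusD _ _) _.
  rewrite modulusN /z cexp0X modulus_cexp expR0.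
  by rewrite -[X in modulus X]/((1 : R)%:C) modulus_real normr1; lra.
by move: m2; rewrite subrX1 modulusM exprMn m1; lra.
Qed.

Lemma fejer0 N : fejer N 0 = N%:R.
Proof.
rewrite /fejer (eq_bigr (fun=> 1)); last first.
  move=> j _; rewrite (bigD1 j)//= subnn expr0 big1 ?addr0// => l lj.
  have [k ->] : exists k, (j - l + (l - j))%N = k.+1.
    exists (j - l + (l - j)).-1%N; rewrite prednK// lt0n addn_eq0 !subn_eq0.
    by apply: contra lj => /andP[jl lj]; apply/eqP/val_inj/eqP; rewrite eqn_leq lj jl.
  by rewrite exprS mul0r.
by rewrite sumr_const card_ord.
Qed.

Lemma cos_neq1 (x : R) : 0 < x < 2 * pi -> cos x != 1.
Proof.
move=> x2pi; have s0 : 0 < sin (x / 2) by apply: sin_gt0_pi; lra.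
have -> : x = x / 2 + x / 2 by lra.
have := cos2Dsin2 (x / 2); rewrite cosD -!expr2 => h.
by rewrite lt_eqF//; have := exprn_gt0 2 s0; lra.
Qed.

Variables (N : nat) (N0 : (0 < N)%N).

Definition node (m : nat) : R := 2 * pi / N%:R * m%:R.

Lemma NR0 : 0 < N%:R :> R.
Proof. by rewrite ltr0n. Qed.

(** The powers of [zeta] occurring in the kernel are below [N], so that only
    those with [j = l] survive the sum over the [N] equidistant nodes. *)
Lemma sum_fejer_nodes t :
  \sum_(m < N) fejer N (cexp 0 (t - node m)) = (N ^ 2)%:R.
Proof.
have NR := NR0; have NR1 : N%:R != 0 :> R by rewrite gt_eqF.
pose w : C := cexp 0 (- (2 * pi / N%:R)).
have wE m : cexp 0 (t - node m) = cexp 0 t * w ^+ m.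
  by rewrite /w cexp0X -cexpD addr0 /node mulNrn -(mulr_natr (2 * pi / N%:R)).
have sum0 (k : nat) : (0 < k < N)%N -> \sum_(m < N) (cexp 0 (t - node m) : C) ^+ k = 0.
  move=> /andP[k0 kN].
  rewrite (eq_bigr (fun m : 'I_N => cexp 0 t ^+ k * (w ^+ k) ^+ m)); last first.
    by move=> m _; rewrite wE exprMn -!exprM mulnC.
  rewrite -mulr_sumr; apply/eqP; rewrite mulf_eq0; apply/orP; right.
  have wN : (w ^+ k) ^+ N = 1.
    rewrite -exprM mulnC exprM /w cexp0X mulNrn -(mulr_natr (2 * pi / N%:R)) divfK//.
    have -> : cexp 0 (- (2 * pi)) = 1 :> C.
      apply/eqP; rewrite eq_complex /= cosN sinN expR0 !mul1r.
      by rewrite mulr_natl cos2pi sin2pi oppr0 !eqxx.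
    by rewrite expr1n.
  have := subrX1 (w ^+ k) N; rewrite wN subrr => /esym/eqP.
  rewrite mulf_eq0 => /orP[|//]; rewrite subr_eq0 /w cexp0X eq_complex /= expR0 mul1r.
  case/andP => + _; rewrite mulNrn cosN => /eqP c1; exfalso.
  suff range : 0 < (2 * pi / N%:R : R) *+ k < 2 * pi.
    by have := cos_neq1 range; rewrite c1 eqxx.
  have p0 := @pi_gt0 R.
  rewrite -(mulr_natr (2 * pi / N%:R)) mulrAC; apply/andP; split.
    by rewrite divr_gt0// mulr_gt0 ?ltr0n// mulr_gt0.
  by rewrite ltr_pdivrMr// ltr_pM2l ?mulr_gt0// ltr_nat.
rewrite /fejer exchange_big /=.
rewrite (eq_bigr (fun=> N%:R)) ?sumr_const ?card_ord ?natrX ?expr2 ?mulr_natr// => j _.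
rewrite exchange_big /= (bigD1 j)//= [X in _ + X]big1 ?addr0.
  rewrite (eq_bigr (fun=> 1)) ?sumr_const ?card_ord// => m _.
  by rewrite subnn expr0.
move=> l lj; apply: sum0; apply/andP; split.
  rewrite lt0n addn_eq0 !subn_eq0.
  by apply: contra lj => /andP[jl lj]; apply/eqP/val_inj/eqP; rewrite eqn_leq lj jl.
have jN := ltn_ord j; have lN := ltn_ord l.
have [h|/ltnW h] := leqP l j; rewrite (eqP h) ?addn0 ?add0n.
  by apply: leq_ltn_trans (leq_subr _ _) _.
by apply: leq_ltn_trans (leq_subr _ _) _.
Qed.

Lemma riemann_sum_le (phi : R -> R) (L : R) :
  (forall s t, `|phi s - phi t| <= L * `|s - t|) ->
  2 * pi / N%:R * \sum_(m < N) phi (node m) <=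
  segment_integral phi 0 (2 * pi) + L * (2 * pi) ^+ 2 / N%:R.
Proof.
move=> lip; set h : R := 2 * pi / N%:R.
have h0 : 0 < h by rewrite divr_gt0 ?NR0// mulr_gt0// pi_gt0.
have L0 : 0 <= L by have := le_trans (normr_ge0 _) (lip 1 0); rewrite subr0 normr1 mulr1.
have cphi a b : segment_continuous phi a b.
  move=> x _; apply/cvgrPdist_lt => e e0; near=> y.
  apply: le_lt_trans (lip _ _) _; apply: le_lt_trans (_ : (L + 1) * `|x - y| < _).
    by rewrite ler_wpM2r// lerDl.
  rewrite mulrC -ltr_pdivlMr ?ltr_wpDl//; near: y; apply: cvgr_dist_lt => //.
  by rewrite divr_gt0// ltr_wpDl.
have step k : h * \sum_(m < k) phi (node m) <=
    segment_integral phi 0 (node k) + k%:R * (L * h ^+ 2).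
  elim: k => [|k IH].
    by rewrite big_ord0 mulr0 mul0r addr0 /node mulr0 /segment_integral set_itv1 Rintegral_set1.
  have nS : node k.+1 = node k + h by rewrite /node -[k.+1%:R]natr1 mulrDr mulr1.
  have n0 : 0 <= node k by rewrite /node mulr_ge0// ltW.
  rewrite big_ord_recr /= mulrDr nS.
  rewrite (@segment_integral_split _ phi 0 (node k + h) (node k))//; last by rewrite lerDl ltW.
  have nkh : node k <= node k + h by rewrite lerDl ltW.
  have : `|segment_integral phi (node k) (node k + h) - phi (node k) * (node k + h - node k)|
      <= L * h * (node k + h - node k).
    apply: segment_integral_near => // x xk; apply: le_trans (lip _ _) _.
    by rewrite ler_wpM2l// ger0_norm; lra.
  rewrite (addrC (node k)) addrK.
  rewrite ler_norml => /andP[lo _].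
  by rewrite -[k.+1%:R]natr1 mulrDl mul1r; lra.
have := step N; rewrite /node divfK ?gt_eqF ?NR0// => /le_trans; apply.
rewrite lerD2l /h expr2 le_eqVlt; apply/orP; left; apply/eqP; field.
by rewrite gt_eqF ?NR0.
Unshelve. all: by end_near. Qed.

End FejerKernel.

(** * Holomorphic majorants on a circle *)

Section CircleMajorant.
Context {R : realType}.
Local Notation C := (R[i]^o).

Lemma derivable_exprn (f : C -> C) (z : C) k :
  derivable f z 1 -> derivable (fun w => f w ^+ k) z 1.
Proof.
move=> df; elim: k => [|k IH].
  by under [X in derivable X]funext do rewrite expr0; exact: derivable_cst.
under [X in derivable X]funext do rewrite exprS.
exact: (@derivableM R[i] C f (fun w => f w ^+ k) z 1 df IH).
Qed.

Lemma derivable_bigsum n (F : 'I_n -> C -> C) (z : C) :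
  (forall i, derivable (F i) z 1) -> derivable (fun w => \sum_(i < n) F i w) z 1.
Proof.
move=> dF; rewrite (_ : (fun w => _) = \sum_(i < n) F i); first exact: derivable_sum.
by apply/funext => w; rewrite fct_sumE.
Qed.

Lemma derivable_fejer N (c z : C) : derivable (fun w : C => fejer N (w * c) : C) z 1.
Proof.
apply: derivable_bigsum => j; apply: derivable_bigsum => l; apply: derivable_exprn.
by apply: derivableM; [exact: derivable_id|exact: derivable_cst].
Qed.

Lemma cos_lipschitz (a b : R) : `|cos a - cos b| <= `|a - b|.
Proof.
wlog ab : a b / a <= b.
  by move=> H; have [/H//|/ltW/H] := leP a b; rewrite distrC (distrC b).
have [|c _ E] := @MVT_segment R cos (fun x => - sin x) a b ab (fun x _ => is_derive_cos x).
  by apply: continuous_subspaceT => x; exact: continuous_cos.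
rewrite distrC E normrM (distrC a) -[leRHS]mul1r ler_wpM2r// normrN; exact: sin_max.
Qed.

Variables (v : R -> R) (v01 : forall t, 0 <= v t <= 1).

(** The sup-convolution of [v] with the squared chordal distance
    [2 (1 - cos (s - t))]; this penalty, rather than [`|s - t|], is the one
    against which the Fejer kernel is controlled. *)
Definition chordal_envelope (n : R) (t : R) : R :=
  sup (range (fun s => v s - n * (1 - cos (s - t)))).

Section Envelope.
Variables (n : R) (n0 : 0 <= n).

Lemma chord_ge0 (x : R) : 0 <= 1 - cos x.
Proof. by rewrite subr_ge0 (le_trans (ler_norm _))// cos_max. Qed.

Lemma chordal_envelope_ub t :
  ubound (range (fun s => v s - n * (1 - cos (s - t)))) 1.
Proof.
move=> _ [s _ <-]; have /andP[_ v1] := v01 s.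
by have := mulr_ge0 n0 (chord_ge0 (s - t)); lra.
Qed.

Lemma chordal_envelope_ge s t : v s - n * (1 - cos (s - t)) <= chordal_envelope n t.
Proof.
apply: ub_le_sup; last by exists s.
by exists 1; exact: chordal_envelope_ub.
Qed.

Lemma chordal_envelope_le t (c : R) :
  (forall s, v s - n * (1 - cos (s - t)) <= c) -> chordal_envelope n t <= c.
Proof.
move=> vc; apply: ge_sup; first by exists (v 0 - n * (1 - cos (0 - t))), 0.
by move=> _ [s _ <-].
Qed.

Lemma le_chordal_envelope t : v t <= chordal_envelope n t.
Proof.
by apply: le_trans (chordal_envelope_ge t t); rewrite subrr cos0 subrr mulr0 subr0.
Qed.

Lemma chordal_envelope_lipschitz s t :
  `|chordal_envelope n s - chordal_envelope n t| <= n * `|s - t|.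
Proof.
have main a b : chordal_envelope n a <= chordal_envelope n b + n * `|a - b|.
  apply: chordal_envelope_le => x; have := chordal_envelope_ge x b.
  have : n * (cos (x - a) - cos (x - b)) <= n * `|a - b|.
    rewrite ler_wpM2l// (le_trans (ler_norm _))// (le_trans (cos_lipschitz _ _))//.
    have -> : x - a - (x - b) = b - a by ring.
    by rewrite distrC.
  lra.
have := main s t; have := main t s; rewrite (distrC t) ler_norml => ? ?.
by apply/andP; split; lra.
Qed.

Lemma chordal_envelope_continuous : continuous (chordal_envelope n).
Proof.
move=> x; apply/cvgrPdist_lt => e e0; near=> y.
apply: le_lt_trans (chordal_envelope_lipschitz _ _) _.
apply: le_lt_trans (_ : (n + 1) * `|x - y| < _).
  by rewrite ler_wpM2r// lerDl.
rewrite mulrC -ltr_pdivlMr ?ltr_wpDl//; near: y; apply: cvgr_dist_lt => //.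
by rewrite divr_gt0// ltr_wpDl.
Unshelve. all: by end_near. Qed.

(** Averaging translates of the Fejer kernel with the values of the envelope at
    equidistant nodes as weights gives a polynomial above [v] on the circle,
    whose value at the centre is a Riemann sum. *)
Lemma holomorphic_majorant (e : R) : 0 < e ->
  exists p : C -> C, [/\ forall z, derivable p z 1,
    forall t, v t <= Re (p (cexp 0 t)) &
    2 * pi * Re (p 0) <= segment_integral (chordal_envelope n) 0 (2 * pi) + e].
Proof.
move=> e0; set phi := chordal_envelope n.
have p0 := @pi_gt0 R.
pose D : R := n * (2 * pi) ^+ 2 + 2 * pi * (2 * n).
have D0 : 0 <= D by rewrite addr_ge0// mulr_ge0// ?sqr_ge0// mulr_ge0// ltW.
(* D / N bounds the error of the Riemann sum plus the effect of the constant
   term 2 n / N of p, which makes up for the spread of the kernel *)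
pose N := (Num.bound (D / e)).+1.
have N0 : (0 < N)%N by [].
have NR : 0 < N%:R :> R by rewrite ltr0n.
have DN : D / N%:R <= e.
  rewrite ler_pdivrMr// mulrC -ler_pdivrMr// ltW//.
  rewrite (lt_trans (archi_boundP (divr_ge0 D0 (ltW e0))))// ltr_nat.
  by rewrite /N.
pose a (m : nat) : C := cexp 0 (- node N m).
pose p (w : C) : C := ((N%:R ^+ 2)^-1)%:C * (\sum_(m < N) (phi (node N m))%:C * fejer N (w * a m))
   + (2 * n / N%:R)%:C.
have ReZ (x : R) (z : C) : Re (x%:C * z) = x * Re z.
  by rewrite ReM /= mul0r subr0.
have Rep w : Re (p w) = (N%:R ^+ 2)^-1 *
    (\sum_(m < N) phi (node N m) * Re (fejer N (w * a m))) + 2 * n / N%:R.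
  rewrite /p ReD ReZ Re_sum /=; congr (_ * _ + _); apply: eq_bigr => m _.
  by rewrite ReZ.
exists p; split.
- move=> z; apply: derivableD; last exact: derivable_cst.
  apply: derivableM; first exact: derivable_cst.
  apply: derivable_bigsum => m; apply: derivableM; first exact: derivable_cst.
  exact: derivable_fejer.
- move=> t; rewrite Rep.
  have za m : cexp 0 t * a m = cexp 0 (t - node N m) by rewrite /a -cexpD addr0.
  have Nfejer : \sum_(m < N) Re (fejer N (cexp 0 t * a m)) = N%:R ^+ 2.
    rewrite -Re_sum (eq_bigr (fun m : 'I_N => fejer N (cexp 0 (t - node N m)))).
      rewrite sum_fejer_nodes// -natrX.
      have -> : ((N ^ 2)%:R : C) = ((N ^ 2)%:R : R)%:C by rewrite rmorph_nat.
      by [].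
    by move=> m _; rewrite za.
  have lo : N%:R ^+ 2 * v t - n * (N%:R * 2) <=
      \sum_(m < N) phi (node N m) * Re (fejer N (cexp 0 t * a m)).
    rewrite -Nfejer mulr_suml -[X in n * (X * 2)]/(N%:R).
    have -> : n * (N%:R * 2) = \sum_(m < N) n * 2 :> R.
      by rewrite sumr_const card_ord -(mulr_natr (n * 2)); ring.
    rewrite -sumrB; apply: ler_sum => m _; rewrite za.
    have F0 := Re_fejer_ge0 N (t - node N m); have F2 := Re_fejer_le N (t - node N m).
    set F := Re _ in F0 F2 *.
    have := ler_wpM2r F0 (chordal_envelope_ge t (node N m)).
    have := ler_wpM2l n0 F2; rewrite -/phi; lra.
  rewrite -lerBlDr -(@ler_pM2l _ (N%:R ^+ 2)) ?exprn_gt0//.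
  rewrite mulrA mulfV ?mul1r ?gt_eqF ?exprn_gt0//.
  apply: le_trans lo; rewrite le_eqVlt; apply/orP; left; apply/eqP.
  by field; rewrite gt_eqF.
- rewrite Rep.
  have -> : \sum_(m < N) phi (node N m) * Re (fejer N (0 * a m)) =
      N%:R * \sum_(m < N) phi (node N m).
    rewrite mulr_sumr; apply: eq_bigr => m _; rewrite mul0r fejer0 mulrC.
    by have -> : (N%:R : C) = (N%:R : R)%:C by rewrite rmorph_nat.
  have := riemann_sum_le N0 chordal_envelope_lipschitz.
  rewrite -/phi; set S := \sum_(m < N) _ => rs.
  have -> : 2 * pi * ((N%:R ^+ 2)^-1 * (N%:R * S) + 2 * n / N%:R) =
     2 * pi / N%:R * S + 2 * pi * (2 * n) / N%:R by field; rewrite gt_eqF.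
  have : D / N%:R = n * (2 * pi) ^+ 2 / N%:R + 2 * pi * (2 * n) / N%:R by rewrite /D mulrDl.
  lra.
Qed.

End Envelope.

(** The chordal envelopes tend to [v], by upper semicontinuity, and dominated
    convergence carries the bounds given by their holomorphic majorants over to
    [v]. *)
Lemma le_circle_mean (c : R) :
  (forall t e, 0 < e -> exists2 d, 0 < d &
     forall s, 1 - cos (s - t) < d -> v s < v t + e) ->
  (forall p : C -> C, (forall z, derivable p z 1) ->
     (forall t, v t <= Re (p (cexp 0 t))) -> c <= Re (p 0)) ->
  (c%:E <= (2 * pi)^-1%:E *
     \int[@lebesgue_measure R]_(t in `[0%R, (2 * pi)%R]) (v t)%:E)%E.
Proof.
move=> usc maj; have p0 := @pi_gt0 R.
have p20 : 0 < 2 * pi :> R by rewrite mulr_gt0.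
pose phi (n : nat) := chordal_envelope n%:R.
have n0 n : 0 <= n%:R :> R by [].
have step n : 2 * pi * c <= segment_integral (phi n) 0 (2 * pi).
  apply/ler_addgt0Pr => e e0.
  have [p [hp pv pe]] := holomorphic_majorant (n0 n) e0.
  by apply: le_trans pe; rewrite ler_pM2l// maj.
have lim : (\int[@lebesgue_measure R]_(t in `[0%R, (2 * pi)%R]) (phi n t)%:E @[n --> \oo] -->
    \int[@lebesgue_measure R]_(t in `[0%R, (2 * pi)%R]) (v t)%:E)%E.
  apply: (@dominated_cvg _ _ R (@lebesgue_measure R) `[0, 2 * pi]%classic
    (measurable_itv _) (fun n t => (phi n t)%:E) (fun t => (v t)%:E) (fun=> 1%:E)) => //.
  - move=> n; apply/measurable_EFinP; apply: measurable_funTS.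
    by apply: continuous_measurable_fun; exact: chordal_envelope_continuous.
  - move=> t _; apply: cvg_EFin; first by near=> n.
    apply/cvgrPdist_le => e e0; have [d d0 dP] := usc t e e0.
    near=> n; rewrite distrC ler_distl; apply/andP; split.
      by have := le_chordal_envelope (n0 n) t; rewrite -/(phi n) /=; lra.
    apply: chordal_envelope_le => s; have [sd|sd] := ltP (1 - cos (s - t)) d.
      have := dP s sd; have := mulr_ge0 (n0 n) (chord_ge0 (s - t)); lra.
    have nd : 1 <= n%:R * d.
      rewrite -ler_pdivrMr// mul1r; near: n; exact: nbhs_infty_ger.
    have := ler_wpM2l (n0 n) sd; have /andP[v0 _] := v01 t; have /andP[_ v1] := v01 s; lra.
  - apply: (@segment_integrable R (fun=> 1)); exact: segment_continuous_cst.
  - move=> n t _; rewrite abse_EFin lee_fin ger0_norm.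
      by apply: ge_sup; [exists (v 0 - n%:R * (1 - cos (0 - t))), 0|exact: chordal_envelope_ub].
    by apply: le_trans (le_chordal_envelope (n0 n) t); case/andP: (v01 t).
rewrite lee_pdivlMl//= -EFinM -(cvg_lim _ lim)//.
apply: lime_ge; first by apply/cvg_ex; eexists; exact: lim.
near=> n; rewrite segment_integral_EFin ?lee_fin//.
by move=> x _; exact: chordal_envelope_continuous.
Unshelve. all: by end_near. Qed.

End CircleMajorant.

(** * Subordination *)

Section Subordination.
Context {R : realType}.
Local Notation C := (R[i]^o).
Local Notation D := (@unit_disk R).

Lemma holomorphic_continuous (U : set C) (f : C -> C) (z : C) :
  holomorphic_on U f -> U z -> {for z, continuous f}.
Proof.
by move=> hf Uz; apply: differentiable_continuous; apply/derivable1_diffP; exact: hf.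
Qed.

Lemma continuous_Re_ge (f : C -> C) (z : C) (e : R) : {for z, continuous f} -> 0 < e ->
  \forall w \near z, Re (f z) - e <= Re (f w).
Proof.
move=> /continuousCP cf e0; have := cf e e0; apply: filterS => w we.
have := le_lt_trans (le_Re_modulus _) we; rewrite ReD ReN ltr_norml => /andP[? ?]; lra.
Qed.

Lemma circle_pointP (z w : C) (r : R) : 0 < r -> modulus (w - z) = r ->
  exists t, w = circle_point z r t.
Proof.
move=> r0; case E : (w - z) => [a b] wr.
have ab : (a / r) ^+ 2 + (b / r) ^+ 2 = 1.
  have : a ^+ 2 + b ^+ 2 = r ^+ 2 by rewrite -wr modulus_sqr.
  by move=> h; rewrite !expr_div_n -mulrDl h mulfV// expf_neq0// gt_eqF.
have a1 : -1 <= a / r <= 1.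
  have : (a / r) ^+ 2 <= 1 by rewrite -ab lerDl sqr_ge0.
  move=> le1; rewrite -ler_norml; suff: `|a / r| ^+ 2 <= 1 by rewrite expr_le1.
  by rewrite real_normK ?num_real.
have ac : cos (acos (a / r)) = a / r by rewrite acosK// in_itv.
have s2 : sin (acos (a / r)) ^+ 2 = (b / r) ^+ 2.
  by have := cos2Dsin2 (acos (a / r)); rewrite ac -ab => /addrI.
have wE t : cos t = a / r -> sin t = b / r -> w = circle_point z r t.
  move=> ct st; rewrite /circle_point ct st !(mulrC r) !divfK ?gt_eqF//.
  by rewrite -E addrC subrK.
move: s2 => /eqP; rewrite eqf_sqr => /orP[/eqP st|/eqP st].
  by exists (acos (a / r)); exact: wE.
by exists (- acos (a / r)); apply: wE; rewrite ?cosN ?sinN// st opprK.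
Qed.

Lemma modulus_circle_pointB (z : C) (r s t : R) :
  modulus (circle_point z r s - circle_point z r t) ^+ 2 = 2 * r ^+ 2 * (1 - cos (s - t)).
Proof.
rewrite modulus_sqr /circle_point opprD addrACA subrr add0r !(ReD, ImD, ReN, ImN) /= cosB.
have := cos2Dsin2 s; have := cos2Dsin2 t => h1 h2.
transitivity (r ^+ 2 * ((cos s ^+ 2 + sin s ^+ 2) + (cos t ^+ 2 + sin t ^+ 2)
   - 2 * (cos s * cos t + sin s * sin t))); first by ring.
by rewrite h1 h2; ring.
Qed.

Lemma subharmonic0 (O : set C) : subharmonic O (fun=> 0%E).
Proof.
move=> z _; split; first exact: ltry.
  by move=> a a0; near=> w.
by exists 1 => // r _; rewrite integral0 mule0.
Unshelve. all: by end_near. Qed.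

Variables (h : C -> C) (A : set C) (u : C -> \bar R).
Hypotheses (hol_h : holomorphic_on D h) (hD : forall z, D z -> D (h z)).
Hypotheses (cA : compact A) (AD : A `<=` D).
Hypothesis sub_u : subharmonic (D `\` A) u.
Hypothesis bd_u : forall zeta, boundary (D `\` A) zeta ->
  (limf_esup u (within (D `\` A) (nbhs zeta)) <= (\1_(boundary A) zeta)%:E)%E.

Local Notation B := (h @` A).

Lemma open_diff_compact (E : set C) : compact E -> open (D `\` E).
Proof.
move=> cE; rewrite setDE; apply: openI; first exact: open_unit_disk.
by apply: closed_openC; exact: compact_closed hausdorffC cE.
Qed.

Lemma boundary_compact (E : set C) : compact E -> boundary E `<=` E.
Proof.
by move=> cE z [clE _]; rewrite (closure_id E).1//; exact: compact_closed hausdorffC cE.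
Qed.

Lemma compact_image_disk (E : set C) : compact E -> E `<=` D -> compact (h @` E).
Proof.
move=> cE ED; apply: continuous_compact => //.
apply: continuous_in_subspaceT => z /set_mem/ED Dz.
exact: holomorphic_continuous hol_h Dz.
Qed.

Let cB : compact B. Proof. exact: compact_image_disk. Qed.

Lemma preimage_diff (x : C) : D x -> ~ B (h x) -> (D `\` A) x.
Proof. by move=> Dx nB; split=> // Ax; apply: nB; exists x. Qed.

Lemma limsup_unit_circle (zeta : C) (e : R) : ~ D zeta -> 0 < e ->
  \forall w \near zeta, (D `\` A) w -> (u w <= e%:E)%E.
Proof.
move=> nD e0; have [cl|ncl] := pselect (closure (D `\` A) zeta).
  have bz : boundary (D `\` A) zeta by split => // /interior_subset[].
  have /limf_esup_within_leP/(_ e e0) := bd_u bz.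
  rewrite indicE memNset ?add0r// => /(boundary_compact cA)/AD; exact: nD.
have : nbhs zeta (~` closure (D `\` A)).
  by apply: open_nbhs_nbhs; split => //; exact/closed_openC/closed_closure.
by apply: filterS => w nw Ow; exfalso; apply: nw; exact: subset_closure.
Qed.

Lemma competitor_le1 z : (D `\` A) z -> (u z <= 1)%E.
Proof.
move=> Oz; apply: (@maximum_principle R (D `\` A) u (fun=> 1) 1) => //.
- exact: open_diff_compact.
- by move=> w [/ltW].
- move=> zeta /bd_u/limf_esup_within_leP uz e e0.
  have := uz e e0; apply: filterS => w uw Ow; apply: le_trans (uw Ow) _.
  by rewrite lee_fin lerD2r indicE /= lern1 leq_b1.
Qed.

(** The competitor for the image: the supremum of [u] over a fibre of [h], cut
    off at [0], which is also its value off the image of [h]. *)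
Definition push_forward (w : C) : \bar R :=
  ereal_sup ([set 0%E] `|` [set u x | x in [set x | D x /\ h x = w]]).

Lemma push_forward_ge0 w : (0 <= push_forward w)%E.
Proof. by apply: ereal_sup_ubound; left. Qed.

Lemma le_push_forward x : D x -> (u x <= push_forward (h x))%E.
Proof. by move=> Dx; apply: ereal_sup_ubound; right; exists x. Qed.

Lemma push_forward_le w (c : \bar R) : (0 <= c)%E ->
  (forall x, D x -> h x = w -> (u x <= c)%E) -> (push_forward w <= c)%E.
Proof. by move=> c0 uc; apply: ge_ereal_sup => _ [->//|[x [Dx hx] <-]]; exact: uc. Qed.

Lemma push_forward_le1 w : ~ B w -> (push_forward w <= 1)%E.
Proof.
move=> nB; apply: push_forward_le => // x Dx hx; apply: competitor_le1.
by apply: preimage_diff => //; rewrite hx.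
Qed.

(** Points of the closed disk near the fibre of [w0] are, by compactness, either
    near a point of this fibre or near the unit circle, where [u] is small. *)
Lemma near_fibre (w0 : C) (b : R) : 0 < b ->
  (forall z, D z -> h z = w0 -> \forall z' \near z, (u z' <= b%:E)%E) ->
  \forall w \near w0, forall x, D x -> h x = w -> (D `\` A) x -> (u x <= b%:E)%E.
Proof.
move=> b0 fib.
have cK : compact [set z : C | modulus z <= 1].
  apply: (@bounded_closed_compactC R _ 1) => //.
  rewrite (_ : mkset _ = [set z : C | modulus (z - 0) <= 1]).
    exact: closed_modulus.
  by apply/seteqP; split => w /=; rewrite subr0.
have /compact_near_coveringP cov := cK.
have := cov C (nbhs w0) (fun w x => D x -> h x = w -> (D `\` A) x -> (u x <= b%:E)%E) (nbhs_filter w0).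
have H z : [set z : C | modulus z <= 1] z ->
    \forall x \near z & w \near w0, D x -> h x = w -> (D `\` A) x -> (u x <= b%:E)%E.
  move=> _; have [Dz|nDz] := pselect (D z); last first.
    have H := limsup_unit_circle nDz b0.
    exists ([set x | (D `\` A) x -> (u x <= b%:E)%E], setT) => /=.
      by split => //; exact: filterT.
    by move=> [x w] [/= H1 _] _ _; exact: H1.
  have [hz|hz] := pselect (h z = w0).
    exists ([set x | (u x <= b%:E)%E], setT) => /=.
      by split; [exact: fib|exact: filterT].
    by move=> [x w] [].
  have d0 : 0 < modulus (h z - w0) / 2.
    by rewrite divr_gt0// modulus_gt0// subr_eq0; apply/eqP.
  have /continuousCP/(_ _ d0) cz := holomorphic_continuous hol_h Dz.
  exists ([set x | modulus (h x - h z) < modulus (h z - w0) / 2],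
          [set w | modulus (w - w0) < modulus (h z - w0) / 2]) => /=.
    by split => //; apply/near_modulus; exists (modulus (h z - w0) / 2).
  move=> [x w] [/= xz ww0] _ hx _; exfalso.
  move: xz ww0; rewrite hx (modulusB w (h z)) => xz ww0.
  by have := modulus_triangle (h z) w w0; lra.
move=> /(_ H); apply: filterS => w wP x Dx; apply: wP => //.
exact: ltW.
Qed.

Lemma push_forward_usc w0 (a : R) : (D `\` B) w0 -> (push_forward w0 < a%:E)%E ->
  \forall w \near w0, (push_forward w < a%:E)%E.
Proof.
move=> OBw0 Ua.
have [a' [Ua' a'a a'0]] : exists a' : R, [/\ (push_forward w0 < a'%:E)%E, a' < a & 0 < a'].
  have U0 := push_forward_ge0 w0; move: U0 Ua.
  case: (push_forward w0) => [r||] //; rewrite !lee_fin !lte_fin => r0 ra.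
  by exists ((r + a) / 2); rewrite lte_fin; split; lra.
have fib z : D z -> h z = w0 -> \forall z' \near z, (u z' <= a'%:E)%E.
  move=> Dz hz; have Oz : (D `\` A) z by apply: preimage_diff; rewrite ?hz; case: OBw0.
  have [_ usc _] := sub_u Oz.
  have uz : (u z < a'%:E)%E by apply: le_lt_trans Ua'; rewrite -hz; exact: le_push_forward.
  by have := usc _ uz; apply: filterS => z' /ltW.
have near1 := near_fibre a'0 fib.
have near2 : nbhs w0 (D `\` B) by apply: open_nbhs_nbhs; split => //; exact: open_diff_compact.
near=> w; apply: (@le_lt_trans _ _ a'%:E); last by rewrite lte_fin.
have [Dw nBw] : (D `\` B) w by near: w.
apply: push_forward_le => [|x Dx hx]; first by rewrite lee_fin ltW.
have nP : forall x, D x -> h x = w -> (D `\` A) x -> (u x <= a'%:E)%E by near: w.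
by apply: nP => //; apply: preimage_diff => //; rewrite hx.
Unshelve. all: by end_near. Qed.

(** A majorant [Re p] of the competitor on a circle stays one at the centre: the
    maximum principle is applied upstairs, on the preimage of the disk. Part of
    the boundary of this preimage may lie on the unit circle; there [u] is small
    and [Re p >= 0]. *)
Lemma push_forward_centre (w0 : C) (r : R) (p : C -> C) : 0 < r ->
  (forall w, modulus (w - w0) <= r -> (D `\` B) w) ->
  (forall z, derivable p z 1) ->
  (forall w, modulus (w - w0) = r -> (push_forward w <= (Re (p w))%:E)%E) ->
  (push_forward w0 <= (Re (p w0))%:E)%E.
Proof.
move=> r0 ballB hp pU.
have cp (z : C) : {for z, continuous p} by apply: (@holomorphic_continuous setT).
have open_ball := @open_modulus R w0 r.
have p_ge0 w : modulus (w - w0) < r -> 0 <= Re (p w).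
  move=> wr; rewrite -lee_fin.
  apply: (@maximum_principle R [set w : C | modulus (w - w0) < r] (fun=> 0%E) p (r + modulus w0)) => //.
  - move=> z /= zr; have := modulusD (z - w0) w0; rewrite subrK; lra.
  - exact: subharmonic0.
  - move=> zeta [clz nz] e e0.
    have zr : modulus (zeta - w0) = r.
      apply/eqP; rewrite eq_le [r <= _]leNgt; apply/andP; split.
        apply: (@closed_modulus R w0 r zeta).
        by apply: closure_subset clz => x /= /ltW.
      apply/negP => zr; apply: nz.
      by rewrite (interior_id _).1.
    have pz : 0 <= Re (p zeta) by rewrite -lee_fin (le_trans (push_forward_ge0 zeta))// pU.
    have := continuous_Re_ge (cp zeta) e0; apply: filterS => x px _.
    by rewrite lee_fin; lra.
have pw0 : 0 <= Re (p w0) by apply: p_ge0; rewrite subrr modulus0.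
apply: push_forward_le => [|x0 Dx0 hx0]; first by rewrite lee_fin.
pose O : set C := [set x | D x /\ modulus (h x - w0) < r].
have OA x : O x -> (D `\` A) x.
  by case=> Dx /ltW/ballB[_ nB]; exact: preimage_diff.
have oO : open O.
  rewrite openE => x [Dx hx]; rewrite /interior.
  have nD : nbhs x D by apply: open_nbhs_nbhs; split => //; exact: open_unit_disk.
  have nh : nbhs (h x) [set w : C | modulus (w - w0) < r] by apply: open_nbhs_nbhs; split.
  have := holomorphic_continuous hol_h Dx nh.
  by move=> /(filterI nD).
have Ox0 : O x0 by split => //; rewrite hx0 subrr modulus0.
rewrite -hx0; apply: (@maximum_principle R O u (p \o h) 1) => //.
- by move=> z [/ltW].
- move=> z /OA Oz; have [uy usc [rho rho0 sm]] := sub_u Oz; split => //.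
  by exists rho.
- move=> z [Dz _]; apply/derivable1_diffP; apply: differentiable_comp.
    by apply/derivable1_diffP; exact: hol_h.
  by apply/derivable1_diffP.
- move=> zeta [clz nOz'] e e0.
  have nOz : ~ O zeta by move=> Oz; apply: nOz'; rewrite (interior_id _).1.
  have [Dz|nDz] := pselect (D zeta); last first.
    have := limsup_unit_circle nDz e0; apply: filterS => x ux Ox.
    apply: le_trans (ux (OA _ Ox)) _; rewrite lee_fin lerDr; apply: p_ge0.
    by case: Ox.
  have ch := holomorphic_continuous hol_h Dz.
  have zr : modulus (h zeta - w0) = r.
    apply/eqP; rewrite eq_le [r <= _]leNgt; apply/andP; split; last first.
      by apply/negP => zr; apply: nOz.
    rewrite leNgt; apply/negP => rz.
    have d0 : 0 < modulus (h zeta - w0) - r by rewrite subr_gt0.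
    have /continuousCP/(_ _ d0) := ch => /clz[x [[_ xr] /= xz]].
    by have := modulus_triangle (h zeta) (h x) w0; rewrite modulusB in xz; lra.
  have [_ nBz] : (D `\` B) (h zeta) by apply: ballB; rewrite zr.
  have Oz := preimage_diff Dz nBz.
  have uz : (u zeta <= (Re (p (h zeta)))%:E)%E.
    by apply: le_trans (le_push_forward Dz) _; exact: pU.
  have [_ usc _] := sub_u Oz.
  have e20 : 0 < e / 2 by rewrite divr_gt0.
  have uz2 : (u zeta < (Re (p (h zeta)) + e / 2)%:E)%E.
    by apply: le_lt_trans uz _; rewrite lte_fin ltrDl.
  have cph : {for zeta, continuous (p \o h)}.
    by apply: continuous_comp; [exact: ch|exact: cp].
  have n1 := usc _ uz2; have n2 := continuous_Re_ge cph e20.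
  near=> x => _; have ux : (u x < (Re (p (h zeta)) + e / 2)%:E)%E by near: x.
  have px : Re (p (h zeta)) - e / 2 <= Re (p (h x)) by near: x.
  by apply: le_trans (ltW ux) _; rewrite lee_fin /=; lra.
Unshelve. all: by end_near. Qed.

Lemma push_forward_fin w : ~ B w -> push_forward w \is a fin_num.
Proof.
move=> nB; apply: fin_real; apply/andP; split.
  exact: lt_le_trans (ltNyr 0) (push_forward_ge0 w).
exact: le_lt_trans (push_forward_le1 nB) (ltry 1).
Qed.

Lemma push_forward_subharmonic : subharmonic (D `\` B) push_forward.
Proof.
move=> w0 OBw0; split.
- by apply: le_lt_trans (ltry 1); apply: push_forward_le1; case: OBw0.
- by move=> a; exact: push_forward_usc.
have /nbhs_modulusP[rho rho0 ballB] : nbhs w0 (D `\` B).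
  by apply: open_nbhs_nbhs; split => //; exact: open_diff_compact.
exists rho => // r /andP[r0 rrho].
have OBc t : (D `\` B) (circle_point w0 r t).
  by apply: ballB; rewrite modulus_circle_point// ltW.
have nBc t : ~ B (circle_point w0 r t) by case: (OBc t).
pose v t := fine (push_forward (circle_point w0 r t)).
have vE t : (v t)%:E = push_forward (circle_point w0 r t).
  by rewrite /v fineK// push_forward_fin.
have v01 t : 0 <= v t <= 1.
  by rewrite -!lee_fin vE push_forward_ge0 push_forward_le1.
have [_ nBw0] := OBw0.
rewrite -(fineK (push_forward_fin nBw0)).
have -> : (fun t => push_forward (circle_point w0 r t)) = (fun t => (v t)%:E).
  by apply/funext => t; rewrite vE.
apply: le_circle_mean => //.
- move=> t e e0.
  have : (push_forward (circle_point w0 r t) < (v t + e)%:E)%E.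
    by rewrite -vE lte_fin ltrDl.
  move=> /(push_forward_usc (OBc t))/near_modulus[d d0 dP].
  have r20 : 0 < 2 * r ^+ 2 by rewrite mulr_gt0// exprn_gt0.
  exists (d ^+ 2 / (2 * r ^+ 2)); first by rewrite divr_gt0// exprn_gt0.
  move=> s sd; rewrite -lte_fin vE; apply: dP.
  rewrite -(@ltr_pXn2r _ 2) ?nnegrE ?modulus_ge0// ?ltW//.
  by rewrite modulus_circle_pointB mulrC -ltr_pdivlMr.
- move=> p hp pv; rewrite -lee_fin fineK ?push_forward_fin//.
  pose q (w : C) : C := p ((w - w0) * (r%:C)^-1).
  have rC : (r%:C : R[i]) != 0 by rewrite eq_complex /= eqxx andbT gt_eqF.
  have -> : p 0 = q w0 by rewrite /q subrr mul0r.
  apply: (@push_forward_centre w0 r q r0).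
  + by move=> w wr; apply: ballB; exact: le_lt_trans wr rrho.
  + move=> z; apply/derivable1_diffP.
    apply: (@differentiable_comp _ _ _ _ (fun w : C => (w - w0) * (r%:C)^-1) p).
      apply/derivable1_diffP; apply: derivableM; last exact: derivable_cst.
      by apply: derivableB; [exact: derivable_id|exact: derivable_cst].
    by apply/derivable1_diffP.
  + move=> w /(circle_pointP r0)[t ->]; rewrite -vE lee_fin /q.
    have -> : (circle_point w0 r t - w0) * (r%:C)^-1 = cexp 0 t; last exact: pv.
    rewrite /circle_point [w0 + _]addrC addrK; apply/eqP; rewrite -(can_eq (mulfK rC)) mulfVK//.
    by rewrite eq_complex /cexp /= expR0 !mul1r !mulr0 subr0 add0r !(mulrC r) !eqxx.
Qed.

Lemma push_forward_boundary zeta : boundary (D `\` B) zeta ->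
  (limf_esup push_forward (within (D `\` B) (nbhs zeta)) <= (\1_(boundary B) zeta)%:E)%E.
Proof.
move=> [clz nz]; apply/limf_esup_within_leP => e e0.
have oB := open_diff_compact cB.
have [Bz|nBz] := pselect (B zeta).
  have bz : boundary B zeta.
    split; first exact: subset_closure.
    by move=> /clz[x [[_ nBx] Bx]].
  rewrite indicE mem_set//; near=> w => -[_ nBw].
  by apply: le_trans (push_forward_le1 nBw) _; rewrite lee_fin lerDl ltW.
have nDz : ~ D zeta.
  by move=> Dz; apply: nz; rewrite (interior_id _).1.
rewrite indicE memNset ?add0r; last by move=> /(boundary_compact cB).
have fib z : D z -> h z = zeta -> \forall z' \near z, (u z' <= e%:E)%E.
  by move=> /hD + hz; rewrite hz.
have := near_fibre e0 fib; apply: filterS => w wP [Dw nBw].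
apply: push_forward_le => [|x Dx hx]; first by rewrite lee_fin ltW.
by apply: wP => //; apply: preimage_diff => //; rewrite hx.
Unshelve. all: by end_near. Qed.

End Subordination.

(** The subordination principle for harmonic measure. The push-forward maps the
    Perron family of the source into that of the target and does not decrease
    values along [h]. *)
Theorem harmonic_measure_subordination (R : realType) (h : R[i]^o -> R[i]^o)
    (A : set R[i]^o) (a : R[i]^o) :
  holomorphic_on unit_disk h -> (forall z, unit_disk z -> unit_disk (h z)) ->
  compact A -> A `<=` unit_disk -> unit_disk a ->
  (harmonic_measure a (boundary A) (unit_disk `\` A) <=
   harmonic_measure (h a) (boundary (h @` A)) (unit_disk `\` h @` A))%E.
Proof.
move=> hol_h hD cA AD Da; apply: ge_ereal_sup => _ [u [su bu] <-].
apply: le_trans (@le_push_forward R h u a Da) _.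
apply: ereal_sup_ubound; exists (push_forward h u) => //; split.
  exact: push_forward_subharmonic.
by move=> zeta; exact: push_forward_boundary.
Qed.

(** * The flow on a petal *)

Section PetalFlow.
Context {R : realType}.
Local Notation C := (R[i]^o).
Variables (phi : R -> C -> C) (Delta : set C).
Hypotheses (sg : holomorphic_semigroup phi) (pet : petal phi Delta).

Lemma petal_sub_disk : Delta `<=` unit_disk.
Proof.
case: pet => -[x _ ->] _ _ _ _ z /connected_component_sub/interior_subset.
case: sg => _ _ phi0 _ _ /(_ 0 (lexx _))[w Dw <-].
by rewrite phi0.
Qed.

(** The inverse used for [t < 0] is a true one since [phi (- t)] maps the petal
    bijectively onto itself. *)
Lemma petal_flowP (t : R) (z : C) : t <= 0 -> Delta z ->
  Delta (petal_flow phi Delta t z) /\ phi (- t) (petal_flow phi Delta t z) = z.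
Proof.
case: sg => _ _ phi0 _ _ t0 Dz; rewrite /petal_flow; case: ifPn => [t0'|].
  have -> : t = 0 by apply: le_anti; rewrite t0 t0'.
  by rewrite oppr0 !phi0 //; exact: petal_sub_disk.
rewrite -ltNge => tlt; case: pet => _ _ aut _ _.
have [[_ inj surj] _ _] := aut (- t) (ltac:(by rewrite oppr_ge0)).
have [y Dy <-] := surj _ Dz.
by rewrite pinvKV ?inE.
Qed.

Lemma petal_flow_inj (r : R) (x y : C) : 0 <= r -> Delta x -> Delta y ->
  phi r x = phi r y -> x = y.
Proof.
case: pet => _ _ aut _ _ r0 Dx Dy; have [[_ inj _] _ _] := aut r r0.
by apply: inj; rewrite inE.
Qed.

Lemma petal_flow_forward (s t : R) (z : C) : s <= t -> t <= 0 -> Delta z ->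
  phi (t - s) (petal_flow phi Delta s z) = petal_flow phi Delta t z.
Proof.
move=> st t0 Dz; have s0 := le_trans st t0.
have ts0 : 0 <= t - s by rewrite subr_ge0.
have nt0 : 0 <= - t by rewrite oppr_ge0.
have [Ds sE] := petal_flowP s0 Dz; have [Dt tE] := petal_flowP t0 Dz.
have Dts : Delta (phi (t - s) (petal_flow phi Delta s z)).
  by case: pet => _ _ aut _ _; have [[fn _ _] _ _] := aut _ ts0; exact: fn.
apply: (@petal_flow_inj (- t)) => //; rewrite tE.
case: sg => _ _ _ add _; rewrite -add//; last exact: petal_sub_disk.
by rewrite addrA addNr add0r.
Qed.

Lemma petal_flow_continuous (t : R) (z : C) : t <= 0 -> Delta z ->
  {for z, continuous (petal_flow phi Delta t)}.
Proof.
case: sg => hol _ _ _ _ t0 Dz; rewrite /petal_flow; case: ifPn => [t0'|].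
  by apply: (holomorphic_continuous (hol t t0')); exact: petal_sub_disk.
rewrite -ltNge => tlt; case: pet => _ _ aut _ _.
have nt0 : 0 <= - t by rewrite oppr_ge0.
have [_ _ hinv] := aut _ nt0.
exact: holomorphic_continuous hinv Dz.
Qed.

End PetalFlow.

Theorem theorem1p1 (R : realType) (phi : R -> R[i]^o -> R[i]^o)
    (Delta K : set R[i]^o) :
  non_elliptic phi -> petal phi Delta ->
  compact K -> K `<=` Delta -> ~ polar K ->
  forall z, (Delta `\` K) z ->
  {in `]-oo, 0] &, nondecreasing_fun (fun t : R =>
     harmonic_measure (petal_flow phi Delta t z)
       (boundary (petal_flow phi Delta t @` K))
       (unit_disk `\` petal_flow phi Delta t @` K))}.
Proof.
move=> [sg _] pet cK KD _ z [Dz _] s t; rewrite !in_itv /= => s0 t0 st.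
have flowD y : Delta y -> unit_disk (petal_flow phi Delta s y).
  by move=> /(petal_flowP sg pet s0)[Dy _]; exact: petal_sub_disk sg pet _ Dy.
have E : petal_flow phi Delta t @` K = phi (t - s) @` (petal_flow phi Delta s @` K).
  rewrite image_comp; apply: eq_imagel => y /KD Dy.
  by rewrite /= (petal_flow_forward sg pet).
rewrite E -(petal_flow_forward sg pet st t0 Dz).
have ts0 : 0 <= t - s by rewrite subr_ge0.
have [hol maps _ _ _] := sg.
apply: harmonic_measure_subordination.
- exact: hol.
- by move=> w; exact: maps.
- apply: continuous_compact => //; apply: continuous_in_subspaceT => y /set_mem/KD Dy.
  exact: petal_flow_continuous sg pet _ _ s0 Dy.
- by move=> _ [y /KD Dy <-]; exact: flowD.
- exact: flowD.
Qed.
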